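(* There is an absolute constant $c$ such that for all $\epsilon,\delta,p>0$, $$S(\epsilon,\delta,p) \le \mathrm{twr}_{1/\epsilon}\big(c\log(1/p)/\delta^2\big).$$ In particular, for every fixed $C,\delta_0>0$ we have $S(p^C,\delta_0,p) \le \mathrm{twr}(O(\log(1/p)))$.
   Context: All graphs are finite and simple. For vertex sets $A,B$, $e_G(A,B)$ is the number of ordered pairs $(u,v)\in A\times B$ with $uv\in E(G)$, $d_G(A,B)=e_G(A,B)/(|A||B|)$. A pair $(A,B)$ is $\epsilon$-regular if $|d_G(A,B)-d_G(A',B')|\le\epsilon$ whenever $A'\subseteq A$, $B'\subseteq B$, $|A'|\ge\epsilon|A|$, $|B'|\ge\epsilon|B|$. An equipartition is a vertex partition whose part sizes differ by at most $1$; its order is its number of parts; an equipartition $\{Z_1,\dots,Z_k\}$ is $\epsilon$-regular if all pairs $(Z_i,Z_j)$ but at most $\epsilon k^2$ are $\epsilon$-regular. The density of $G=(V,E)$ is $2|E|/|V|^2$. $S(\epsilon,\delta,p)$ is the smallest integer $S$ such that for every graph $G$ of density at least $p$ and every equipartition $\mathcal P_0$ of $V(G)$ of order at most $1/\epsilon$, one can add/remove at most $\delta|E(G)|$ edges so that the resulting graph has an $\epsilon$-regular equipartition refining $\mathcal P_0$ of order at most $S$. The tower function: $\mathrm{twr}_y(0)=y$, $\mathrm{twr}_y(x+1)=2^{\mathrm{twr}_y(x)}$ (a tower of $x$ exponents with $y$ at the top), and $\mathrm{twr}(x)=\mathrm{twr}_1(x)$; non-integer heights are rounded up. *)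

(* Defs.v *)
From Stdlib Require Import Reals ClassicalDescription.
From mathcomp Require Import all_boot.

Set Implicit Arguments.
Unset Strict Implicit.
Unset Printing Implicit Defensive.

Local Open Scope R_scope.

Definition asbool (Q : Prop) : bool :=
  if excluded_middle_informative Q then true else false.

(* A finite simple graph on vertex set 'I_n (every finite simple graph is
   isomorphic to one of these), given by its edge set: a set of 2-element
   subsets of the vertex set. *)
Definition graph (n : nat) := {set {set 'I_n}}.

Definition is_graph n (E : graph n) : Prop :=
  forall e, e \in E -> #|e| = 2%N.

Definition nedges n (E : graph n) : nat := #|E|.

Definition e_G n (E : graph n) (A B : {set 'I_n}) : nat :=
  #|[set x : 'I_n * 'I_n | [&& x.1 \in A, x.2 \in B & [set x.1; x.2] \in E]]|.

Definition d_G n (E : graph n) (A B : {set 'I_n}) : R :=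
  INR (e_G E A B) / (INR #|A| * INR #|B|).

Definition density n (E : graph n) : R :=
  2 * INR (nedges E) / (INR n * INR n).

Definition eps_regular_pair n (E : graph n) (eps : R) (A B : {set 'I_n}) : Prop :=
  forall A' B' : {set 'I_n}, A' \subset A -> B' \subset B ->
    eps * INR #|A| <= INR #|A'| -> eps * INR #|B| <= INR #|B'| ->
    Rabs (d_G E A B - d_G E A' B') <= eps.

Definition equipartition n (P : {set {set 'I_n}}) : Prop :=
  partition P [set: 'I_n] /\
  forall A B, A \in P -> B \in P -> (#|A| <= #|B| + 1)%N.

Definition refines n (P Q : {set {set 'I_n}}) : Prop :=
  forall A, A \in P -> exists2 B, B \in Q & A \subset B.

Definition eps_regular_equipartition n (E : graph n) (eps : R)
    (P : {set {set 'I_n}}) : Prop :=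
  equipartition P /\
  INR #|[set x : {set 'I_n} * {set 'I_n} |
            [&& x.1 \in P, x.2 \in P &
                asbool (~ eps_regular_pair E eps x.1 x.2)]]|
     <= eps * INR #|P| * INR #|P|.

Definition S_ok (eps delta p : R) (N : nat) : Prop :=
  forall (n : nat) (E : graph n), is_graph E -> p <= density E ->
  forall P0 : {set {set 'I_n}}, equipartition P0 -> INR #|P0| <= 1 / eps ->
  exists E' : graph n, is_graph E' /\
    INR #|(E :\: E') :|: (E' :\: E)| <= delta * INR (nedges E) /\
    exists P : {set {set 'I_n}},
      refines P P0 /\ (#|P| <= N)%N /\ eps_regular_equipartition E' eps P.

(* S(eps,delta,p): the smallest N with S_ok eps delta p N
   (by convention 0 if no such N exists; by Szemeredi's lemma one exists). *)
Definition S (eps delta p : R) : nat :=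
  match excluded_middle_informative (exists N, asbool (S_ok eps delta p N)) with
  | left H => ex_minn H
  | right _ => 0%N
  end.

Fixpoint twr (y : R) (x : nat) : R :=
  match x with
  | O => y
  | k.+1 => Rpower 2 (twr y k)
  end.

(* ceiling into nat (non-integer heights are rounded up; negatives -> 0) *)
Definition ceil_nat (x : R) : nat := Z.to_nat (- Int_part (- x)).

(* Main.v *)
(** Measure the irregularity of a graph [G] relative to a vertex partition [P]
    by the entropy [sum g_P ln g_P] of the block averages [g_P] of its adjacency
    matrix. Divided by [2|E|] this lies between [ln (density)] and [0], and if a
    refinement [Q] of [P] has [|g_Q - g_P|_1 > (delta/4) 2|E|], a Pinsker-type
    inequality makes it grow by a constant times [delta^2]. Iterating with [Q] a
    weakly regular (Frieze-Kannan) refinement of [P], which costs one exponential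
    per step, we reach after [O(log(1/p)/delta^2)] steps a pair [P, Q] with [g_Q]
    close to [g_P]. Damping [G - g_Q] and adding it to [g_P] yields a weighted
    graph that is close to [G] and within a tiny cut norm of [g_P]; rounding its
    weights to [0] and [1] while controlling codegrees produces the new graph,
    which is regular between any two sets lying inside parts of [P]. An
    equipartition refining [P_0] almost all of whose parts lie inside parts of
    [P] is then regular. No part of [P] needs to be equitable, and small graphs
    are handled by the partition into singletons. *)

Require Import Defs.
From Stdlib Require Import Reals Lra ZArith.
From mathcomp Require Import all_boot all_order all_algebra Rstruct ring lra zify.
Set Implicit Arguments.
Unset Strict Implicit.
Unset Printing Implicit Defensive.
Import Order.TTheory GRing.Theory Num.Theory.

(** * Block averages *)

Section BlockAverages.
Local Open Scope ring_scope.
Variable F : realFieldType.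

(** Entropy is chosen because its whole range is [ln (1/p)] in units of [2|E|], while an L1 change
    of [d * 2|E|] raises it by [d ^ 2 / 4] of that unit. For the L2 energy the same change
    guarantees only [p * d ^ 2], which would make the number of steps polynomial in [1/p]. Damping
    is what lets the edit budget be spent on averages: fading edges, or non-edges, within a block
    moves all entries the same way, so the damped graph is exactly as far from [G] in L1 as [g_Q] is
    from [g_P]. The price is that weak regularity has to hold with damping weights, which change
    with [Q] but stay constant on its blocks. The precision asked of [Q] shrinks with the number of
    parts of [P], since regularity is finally tested on far smaller sets; the number of parts of [Q]
    never enters the order of the result. The given equipartition enters only at the end, so the
    iteration starts from a single class, and [eps] acts only through that precision: it sits at the
    top of the tower and leaves the height alone. *)

Lemma cauchy_schwarz (I : finType) (a b : I -> F) :
  (\sum_i a i * b i) ^+ 2 <= (\sum_i a i ^+ 2) * (\sum_i b i ^+ 2).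
Proof.
have H : 0 <= \sum_i \sum_j (a i * b j - a j * b i) ^+ 2.
  by apply: sumr_ge0 => i _; apply: sumr_ge0 => j _; apply: sqr_ge0.
have E : \sum_i \sum_j (a i * b j - a j * b i) ^+ 2 =
   2 * ((\sum_i a i ^+ 2) * (\sum_i b i ^+ 2)) - 2 * (\sum_i a i * b i) ^+ 2.
  transitivity (\sum_i \sum_j (a i ^+ 2 * b j ^+ 2 + b i ^+ 2 * a j ^+ 2
                 - 2 * ((a i * b i) * (a j * b j)))).
    by apply: eq_bigr => i _; apply: eq_bigr => j _; ring.
  under eq_bigr => i _ do rewrite big_split /= big_split /= sumrN -!mulr_sumr.
  rewrite big_split /= big_split /= sumrN -!mulr_sumr -!mulr_suml.
  by ring.
by lra.
Qed.

Lemma sum_sqr_le (I : finType) (a : I -> F) :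
  (\sum_i a i) ^+ 2 <= #|I|%:R * \sum_i a i ^+ 2.
Proof.
have := cauchy_schwarz (fun=> 1) a.
under eq_bigr do rewrite mul1r.
by under [X in _ <= X * _ -> _]eq_bigr do rewrite expr1n; rewrite sumr_const.
Qed.

Section Avg.
Variables (Om : finType) (L : eqType).
Implicit Types (pi : Om -> L) (g u : Om -> F).

Definition avg pi g (w : Om) : F :=
  (\sum_(v | pi v == pi w) g v) / #|[pred v | pi v == pi w]|%:R.

Lemma block_gt0 pi w : 0 < #|[pred v | pi v == pi w]|%:R :> F.
Proof. by rewrite ltr0n; apply/card_gt0P; exists w; rewrite inE eqxx. Qed.

Lemma avg_eq pi g w v : pi w = pi v -> avg pi g w = avg pi g v.
Proof. by rewrite /avg => ->. Qed.

Lemma sum_avg pi g u : (forall w v, pi w = pi v -> u w = u v) ->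
  \sum_w u w * avg pi g w = \sum_w u w * g w.
Proof.
move=> Hu.
transitivity (\sum_w \sum_(v | pi v == pi w)
    u v * g v / #|[pred z | pi z == pi v]|%:R).
  apply: eq_bigr => w _; rewrite /avg mulrA mulr_sumr mulr_suml.
  by apply: eq_bigr => v /eqP Ev; rewrite (Hu v w Ev) Ev.
rewrite (exchange_big_dep predT) //=; apply: eq_bigr => v _.
have E : (fun w => pi v == pi w) =1 (fun w => pi w == pi v).
  by move=> w; rewrite eq_sym.
rewrite (eq_bigl _ _ E) sumr_const -[X in X *+ _]mulr1 -mulrnAr -mulrA -mulr_natr.
rewrite mul1r mulVf ?mulr1 //.
by rewrite gt_eqF // block_gt0.
Qed.

Lemma sum_avg1 pi g : \sum_w avg pi g w = \sum_w g w.
Proof.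
have := @sum_avg pi g (fun=> 1) (fun _ _ _ => erefl).
by under eq_bigr do rewrite mul1r; under [RHS]eq_bigr do rewrite mul1r.
Qed.

Lemma avg_ge0 pi g w : (forall v, 0 <= g v) -> 0 <= avg pi g w.
Proof. by move=> g0; apply: divr_ge0 => //; apply: sumr_ge0. Qed.

Lemma avg_le1 pi g w : (forall v, g v <= 1) -> avg pi g w <= 1.
Proof.
move=> g1; rewrite /avg ler_pdivrMr ?block_gt0 // mul1r.
apply: le_trans (ler_sum _ (fun v _ => g1 v)) _.
by rewrite sumr_const.
Qed.

Lemma avg_eq0 pi g w v : (forall v, 0 <= g v) -> avg pi g w = 0 ->
  pi v = pi w -> g v = 0.
Proof.
move=> g0 /eqP; rewrite /avg mulf_eq0 invr_eq0 (gt_eqF (block_gt0 pi w)) orbF.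
move=> /eqP H /eqP Ev; exact: (psumr_eq0P (fun i _ => g0 i) H).
Qed.


End Avg.

Section Refinement.
Variables (Om : finType) (L L' : eqType) (pi : Om -> L) (rho : Om -> L').
Variable g : Om -> F.
Hypothesis ref : forall w v, rho w = rho v -> pi w = pi v.

Lemma sum_avg_refine (u : Om -> F) : (forall w v, pi w = pi v -> u w = u v) ->
  \sum_w u w * avg rho g w = \sum_w u w * avg pi g w.
Proof. by move=> Hu; rewrite !sum_avg // => w v /ref; apply: Hu. Qed.

(** The coarse average is constant on coarse blocks, hence orthogonal to the change made by
    refining. *)
Lemma avg_pythagoras :
  \sum_w (avg rho g w - avg pi g w) ^+ 2 =
  \sum_w avg rho g w ^+ 2 - \sum_w avg pi g w ^+ 2.
Proof.
have H : \sum_w avg pi g w * avg rho g w = \sum_w avg pi g w ^+ 2.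
  rewrite sum_avg_refine; first by apply: eq_bigr => w _; rewrite expr2.
  by move=> w v; apply: avg_eq.
transitivity (\sum_w (avg rho g w ^+ 2 - 2 * (avg pi g w * avg rho g w)
   + avg pi g w ^+ 2)); first by apply: eq_bigr => w _; ring.
by rewrite big_split /= sumrB -mulr_sumr H; ring.
Qed.

End Refinement.
End BlockAverages.

(** * Weak regularity *)

Section Transfer.
Local Open Scope ring_scope.
Variable F : realFieldType.

(* [transfer a b] turns a 0/1 block of density [b] into a weighted block of
   density [a] by fading edges if [a <= b] and non-edges otherwise. At
   [a = b = 0] the quotient is [0], which is harmless as the block is empty. *)
Definition damp (a b : F) : F := if a <= b then a / b else (1 - a) / (1 - b).

Lemma damp_ge0_le1 (a b : F) : 0 <= a <= 1 -> 0 <= b <= 1 ->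
  0 <= damp a b <= 1.
Proof.
move=> /andP[a0 a1] /andP[b0 b1]; rewrite /damp; case: ifPn => [ab|].
  have [b0'|bn0] := eqVneq b 0; first by rewrite b0' invr0 mulr0 lexx ler01.
  have bp : 0 < b by rewrite lt_def bn0.
  by rewrite divr_ge0 //= ler_pdivrMr // mul1r.
rewrite -ltNge => ba; have bp : 0 < 1 - b by lra.
by rewrite divr_ge0 ?ler_pdivrMr //=; lra.
Qed.

Definition transfer (a b g : F) : F := a + damp a b * (g - b).

(** In the first case [damp a b * b = a], in the second [damp a b * (1 - b) = 1 - a], so the
    constant terms cancel. For [b = 0] the quotient is a default value, and [g = 0] makes up for
    it. *)
Lemma transferE (a b g : F) : 0 <= a <= 1 -> 0 <= b <= 1 -> (b = 0 -> g = 0) ->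
  transfer a b g = if a <= b then damp a b * g else 1 - damp a b * (1 - g).
Proof.
move=> /andP[a0 a1] /andP[b0 b1] bg; rewrite /transfer /damp; case: ifPn => [ab|].
  have [b0'|bn0] := eqVneq b 0; last by field.
  by rewrite (bg b0') b0' invr0 in ab *; have -> : a = 0 by [lra|]; ring.
rewrite -ltNge => ba; have bp : 1 - b != 0 by rewrite gt_eqF //; lra.
by field.
Qed.

Lemma transfer_ge0_le1 (a b g : F) : 0 <= a <= 1 -> 0 <= b <= 1 ->
  0 <= g <= 1 -> (b = 0 -> g = 0) -> 0 <= transfer a b g <= 1.
Proof.
move=> ha hb /andP[g0 g1] bg; rewrite transferE //.
have /andP[d0 d1] := damp_ge0_le1 ha hb.
by case: ifP => _; apply/andP; split; nra.
Qed.

(** On a block of [rho] all entries move in the same direction, so nothing cancels: the absolute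
    value is affine in [g w] with block-constant coefficients, and [g] may be replaced by its
    average. *)
Lemma sum_transfer_dist (Om : finType) (L L' : eqType) (pi : Om -> L)
    (rho : Om -> L') (g : Om -> F) :
  (forall w v, rho w = rho v -> pi w = pi v) -> (forall w, 0 <= g w <= 1) ->
  \sum_w `|transfer (avg pi g w) (avg rho g w) (g w) - g w| =
  \sum_w `|avg rho g w - avg pi g w|.
Proof.
move=> ref g01.
have g0 v : 0 <= g v by have /andP[] := g01 v.
have g1 v : g v <= 1 by have /andP[] := g01 v.
have A01 w : 0 <= avg pi g w <= 1 by rewrite avg_ge0 // avg_le1.
have B01 w : 0 <= avg rho g w <= 1 by rewrite avg_ge0 // avg_le1.
pose d w := damp (avg pi g w) (avg rho g w).
pose t w := avg pi g w <= avg rho g w.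
pose u w := if t w then 1 - d w else d w - 1.
pose v w := if t w then 0 else 1 - d w.
have d01 w : 0 <= d w <= 1 by apply: damp_ge0_le1.
have E w : `|transfer (avg pi g w) (avg rho g w) (g w) - g w| = u w * g w + v w.
  rewrite transferE //; last by move=> H; apply: (avg_eq0 g0 H).
  rewrite /u /v /t -/(d w); have /andP[d0 d1] := d01 w.
  have := g0 w; have := g1 w; case: ifP => _ ? ?.
    by rewrite ler0_norm; [ring | nra].
  by rewrite ger0_norm; [ring | nra].
under eq_bigr do rewrite E.
rewrite big_split /= -(@sum_avg _ _ _ rho); last first.
  by move=> w w' H; rewrite /u /d /t !(avg_eq _ H) !(avg_eq _ (ref _ _ H)).
rewrite -big_split /=; apply: eq_bigr => w _; rewrite /u /v /d /t /damp.
have /andP[a0 a1] := A01 w; have /andP[b0 b1] := B01 w.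
case: (boolP (avg pi g w <= avg rho g w)) => [ab|].
  rewrite ger0_norm ?subr_ge0 //.
  have [b0'|bn0] := eqVneq (avg rho g w) 0; last by field.
  by rewrite b0' in ab *; have -> : avg pi g w = 0 by [lra|]; ring.
rewrite -ltNge => ba; rewrite ltr0_norm; last by lra.
have bp : 1 - avg rho g w != 0 by rewrite gt_eqF //; lra.
by field.
Qed.

End Transfer.

Section WeakRegularity.
Local Open Scope ring_scope.
Variables (F : realFieldType) (V : finType).
Implicit Types (g : V * V -> F) (S T : {set V}).

Definition pcol (K : Type) (kappa : V -> K) (w : V * V) := (kappa w.1, kappa w.2).

Definition pavg (K : eqType) (kappa : V -> K) g := avg (pcol kappa) g.

Definition split_col (K : Type) (kappa : V -> K) S T (x : V) : K * (bool * bool) :=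
  (kappa x, (x \in S, x \in T)).

Lemma sum_mem_pair (h : V * V -> F) S T :
  \sum_(x in S) \sum_(y in T) h (x, y) =
  \sum_w ((w.1 \in S) && (w.2 \in T))%:R * h w.
Proof.
rewrite pair_big /= big_mkcond /=; apply: eq_bigr => -[x y] _ /=.
by case: ifP; rewrite ?mul1r ?mul0r.
Qed.

(* If the test [S], [T] detects a discrepancy, then splitting by [S] and [T]
   makes the discrepancy visible in the block averages, and the [L2] energy
   grows by Pythagoras. *)
Lemma energy_increment (K' : eqType) (kappa' : V -> K') g
    (c : V * V -> F) (eta : F) S T :
  (forall w v, pcol kappa' w = pcol kappa' v -> c w = c v) ->
  (forall w, 0 <= c w <= 1) -> 0 <= eta ->
  eta * #|V|%:R ^+ 2 <
    `|\sum_(x in S) \sum_(y in T) c (x, y) * (g (x, y) - pavg kappa' g (x, y))| ->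
  eta ^+ 2 * #|V|%:R ^+ 2 <
    \sum_w pavg (split_col kappa' S T) g w ^+ 2 - \sum_w pavg kappa' g w ^+ 2.
Proof.
move=> Hc c01 eta0; set N2 : F := #|V|%:R ^+ 2.
pose rho := pcol (split_col kappa' S T).
have ref w v : rho w = rho v -> pcol kappa' w = pcol kappa' v.
  by rewrite /pcol => -[-> _ _ -> _ _].
rewrite -(avg_pythagoras g ref) -/N2.
set D := \sum_w _; pose u (w : V * V) := ((w.1 \in S) && (w.2 \in T))%:R * c w : F.
(* The weight [c] is constant on the blocks of [kappa'], so the weighted test function is still
   constant on the split blocks. *)
have Hu w v : rho w = rho v -> u w = u v.
  move=> H; have := Hc _ _ (ref _ _ H); rewrite /u => ->.
  by case: H => _ -> _ _ _ ->.
rewrite (sum_mem_pair (fun w => c w * (g w - pavg kappa' g w))).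
set X := \sum_w _.
have XE : X = \sum_w u w * (avg rho g w - pavg kappa' g w).
  transitivity (\sum_w u w * g w - \sum_w u w * pavg kappa' g w).
    by rewrite -sumrB; apply: eq_bigr => w _; rewrite /u -!mulrA mulrBr mulrBr.
  rewrite -(sum_avg g Hu) -sumrB.
  by apply: eq_bigr => w _; rewrite mulrBr.
have X2 : X ^+ 2 <= N2 * D.
  rewrite XE; apply: le_trans (cauchy_schwarz _ _) _.
  apply: ler_wpM2r; first by apply: sumr_ge0 => w _; apply: sqr_ge0.
  have -> : N2 = \sum_(w : V * V) 1 by rewrite sumr_const card_prod natrM.
  apply: ler_sum => w _; rewrite /u.
  have /andP[? ?] := c01 w; case: (_ && _); rewrite ?mul1r ?mul0r; nra.
have N20 : 0 <= N2 by apply: sqr_ge0.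
move=> H; have : (eta * N2) ^+ 2 < X ^+ 2.
  by rewrite -[X in _ < X]real_normK ?num_real // ltr_pXn2r ?nnegrE ?mulr_ge0.
rewrite exprMn (_ : _ * N2 ^+ 2 = N2 * (eta ^+ 2 * N2)); last by ring.
move=> /lt_le_trans /(_ X2) H3; rewrite -(@ltr_pM2l _ N2) //.
by rewrite lt_def N20 andbT; apply: contraTneq H3 => ->; rewrite !mul0r ltxx.
Qed.

(** The summand is the damped graph minus the averages over [kappa], so this bounds the cut norm of
    that difference. The Frieze-Kannan condition is the case of weight one. *)
Definition weakly_regular (K K' : eqType) (kappa : V -> K) (kappa' : V -> K') g
    (eta : F) := forall S T,
  `|\sum_(x in S) \sum_(y in T)
      damp (pavg kappa g (x, y)) (pavg kappa' g (x, y)) *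
      (g (x, y) - pavg kappa' g (x, y))| <= eta * #|V|%:R ^+ 2.

(** A failing test multiplies the number of classes by at most 4 and adds more than [eta ^ 2 * N2]
    to an energy confined to [[0, N2]], so fewer than [J] splittings occur. *)
Lemma weak_regularity (K : finType) (kappa : V -> K) g (eta : F) (J : nat) :
  (forall w, 0 <= g w <= 1) -> 0 < eta -> 1 < J%:R * eta ^+ 2 ->
  exists (K' : finType) (kappa' : V -> K'),
    [/\ forall x y, kappa' x = kappa' y -> kappa x = kappa y,
        (#|K'| <= #|K| * 4 ^ J)%N & weakly_regular kappa kappa' g eta].
Proof.
move=> g01 eta0 HJ.
have g0 v : 0 <= g v by have /andP[] := g01 v.
have g1 v : g v <= 1 by have /andP[] := g01 v.
set N2 : F := #|V|%:R ^+ 2.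
have N20 : 0 <= N2 by apply: sqr_ge0.
have avg01 (K' : eqType) (k' : V -> K') w : 0 <= pavg k' g w <= 1.
  by rewrite avg_ge0 // avg_le1.
have en_le (K' : eqType) (k' : V -> K') : \sum_w pavg k' g w ^+ 2 <= N2.
  have -> : N2 = \sum_(w : V * V) 1 by rewrite sumr_const card_prod natrM.
  by apply: ler_sum => w _; have /andP[? ?] := avg01 _ k' w; nra.
have incr (K' : finType) (k' : V -> K') :
    (forall x y, k' x = k' y -> kappa x = kappa y) -> forall S T,
    eta * N2 < `|\sum_(x in S) \sum_(y in T)
      damp (pavg kappa g (x, y)) (pavg k' g (x, y)) *
      (g (x, y) - pavg k' g (x, y))| ->
    eta ^+ 2 * N2 <
    \sum_w pavg (split_col k' S T) g w ^+ 2 - \sum_w pavg k' g w ^+ 2.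
  move=> ref S T.
  apply: (energy_increment (c := fun w => damp (pavg kappa g w) (pavg k' g w))).
  - move=> w v E; rewrite /pavg (avg_eq g E); congr (damp _ _); apply: avg_eq.
    by case: E => /ref E1 /ref E2; rewrite /pcol E1 E2.
  - by move=> w; apply: damp_ge0_le1.
  exact: ltW.
(* Here [j] counts the splittings still affordable; at [j = 0] the energy is already maximal and no
   test can fail. *)
have main (j : nat) (K' : finType) (k' : V -> K') :
    (forall x y, k' x = k' y -> kappa x = kappa y) ->
    N2 <= \sum_w pavg k' g w ^+ 2 + j%:R * (eta ^+ 2 * N2) ->
    exists (K'' : finType) (kappa' : V -> K''),
    [/\ forall x y, kappa' x = kappa' y -> kappa x = kappa y,
        (#|K''| <= #|K'| * 4 ^ j)%N & weakly_regular kappa kappa' g eta].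
  have dec (K'' : finType) (k'' : V -> K'') :
      weakly_regular kappa k'' g eta \/ exists S T, eta * N2 <
      `|\sum_(x in S) \sum_(y in T)
      damp (pavg kappa g (x, y)) (pavg k'' g (x, y)) *
      (g (x, y) - pavg k'' g (x, y))|.
    pose disc (S T : {set V}) := `|\sum_(x in S) \sum_(y in T)
      damp (pavg kappa g (x, y)) (pavg k'' g (x, y)) *
      (g (x, y) - pavg k'' g (x, y))|.
    have [/existsP[S /existsP[T ST]]|wr] :=
      boolP [exists S : {set V}, exists T : {set V}, eta * N2 < disc S T].
      by right; exists S, T.
    left=> S T; move: wr; rewrite negb_exists => /forallP/(_ S).
    by rewrite negb_exists => /forallP/(_ T); rewrite -leNgt.
  elim: j K' k' => [|j IH] K' k' ref Hen.
    exists K', k'; split; rewrite ?expn0 ?muln1 //.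
    have [//|[S [T ST]]] := dec _ k'.
    have := incr _ _ ref _ _ ST; have := en_le _ (split_col k' S T).
    have : 0 <= eta ^+ 2 * N2 by rewrite mulr_ge0 ?sqr_ge0.
    by rewrite mul0r in Hen; lra.
  have [wr|[S [T ST]]] := dec _ k'.
    by exists K', k'; split=> //; rewrite leq_pmulr ?expn_gt0.
  have inc := incr _ _ ref _ _ ST.
  have [||K'' [k'' [r2 c2 w2]]] := IH _ (split_col k' S T).
  - by move=> x y [/ref].
  - apply: le_trans Hen _; rewrite mulrS mulrDl mul1r addrA lerD2r -lerBrDl.
    exact: ltW.
  exists K'', k''; split=> //; apply: leq_trans c2 _.
  by rewrite !card_prod card_bool expnS !mulnA -(mulnA _ 2 2).
apply: (main J K kappa) => //.
rewrite -[X in X <= _]add0r; apply: lerD.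
  by apply: sumr_ge0 => w _; apply: sqr_ge0.
by rewrite mulrA ler_peMl // ltW.
Qed.
End WeakRegularity.

(** * Rounding a weighted graph *)

Section Rounding.
Local Open Scope ring_scope.
Variable F : realFieldType.

Definition upd (I : eqType) (h : I -> F) (i : I) (u : F) (j : I) :=
  if j == i then u else h j.

(* Method of conditional expectations: a coordinate is set to 1 with
   probability [f i] and to 0 otherwise, and some choice does not exceed the
   mean of the potential. *)
Lemma round_coordinates (I : eqType) (f : I -> F) (Phi : (I -> F) -> F) (B : F)
    (s : seq I) :
  uniq s -> (forall i, 0 <= f i <= 1) ->
  (forall h i, i \in s -> (forall j, 0 <= h j <= 1) -> h i = f i ->
     f i * Phi (upd h i 1) + (1 - f i) * Phi (upd h i 0) <= Phi h + B) ->
  exists h, [/\ forall j, 0 <= h j <= 1, forall i, i \in s -> h i = 0 \/ h i = 1,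
    forall i, i \notin s -> h i = f i & Phi h <= Phi f + B * (size s)%:R].
Proof.
move=> + f01; elim: s => [_ _|i s IH /= /andP[i_s us] step].
  by exists f; rewrite mulr0 addr0.
have [|h [h01 hs hns Hh]] := IH us.
  by move=> h j js; apply: step; rewrite inE js orbT.
have {step} := step h i (mem_head _ _) h01 (hns _ i_s).
have /andP[f0 f1] := f01 i; set P1 := Phi (upd h i 1); set P0 := Phi _ => step.
have [u [u01 Hu]] : exists u : F, (u = 0 \/ u = 1) /\ Phi (upd h i u) <= Phi h + B.
  have [H1|H1] := lerP P1 (Phi h + B); first by exists 1; split; [right|].
  exists 0; split; [by left | rewrite -/P0 leNgt; apply/negP => H0].
  have [fi0|fi0] := eqVneq (f i) 0.
    by move: step; rewrite fi0 mul0r subr0 mul1r; lra.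
  have : 0 < f i * (P1 - (Phi h + B)) by rewrite mulr_gt0 ?subr_gt0 // lt_def fi0.
  have : 0 <= (1 - f i) * (P0 - (Phi h + B)) by rewrite mulr_ge0 // subr_ge0 // ltW.
  lra.
exists (upd h i u); split.
- move=> j; rewrite /upd; case: eqP => // _; by case: u01 => ->; rewrite lexx ler01.
- move=> j; rewrite inE /upd; case: eqP => //= _ js; exact: hs.
- move=> j; rewrite inE negb_or /upd => /andP[/negbTE-> js]; exact: hns.
apply: le_trans Hu _; rewrite -[(size s).+1]add1n natrD mulrDr mulr1; lra.
Qed.

Variable V : finType.
Local Notation N := (#|V|%:R : F).
Implicit Types M h f : V * V -> F.

Definition codeg M x x' := \sum_y M (x, y) * M (x', y).

(* Without the diagonal terms, every codegree in the sum is affine in each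
   single entry of [M]. *)
Definition codeg_energy M := \sum_(w | w.1 != w.2) codeg M w.1 w.2 ^+ 2.

(** Since [x] and [x'] differ, the entry [(a, b)] occurs in at most one factor of one product, and
    no quadratic term in [t] arises. *)
Lemma codeg_upd M M' a b t x x' : M (a, b) = 0 -> M' (a, b) = t ->
  (forall w, w != (a, b) -> M' w = M w) -> x != x' ->
  codeg M' x x' = codeg M x x' + t * ((x == a)%:R * M (x', b) + (x' == a)%:R * M (x, b)).
Proof.
move=> M0 M't M'M xx'; rewrite /codeg (bigD1 b) //= [in RHS](bigD1 b) //=.
rewrite addrAC; congr (_ + _); last first.
  by apply: eq_bigr => y yb; rewrite !M'M // xpair_eqE (negbTE yb) andbF.
have [xa|xa] := eqVneq x a.
  have x'a : x' != a by rewrite -xa eq_sym.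
  rewrite xa M0 M't M'M; first by rewrite (negbTE x'a) /=; ring.
  by rewrite xpair_eqE (negbTE x'a).
rewrite (M'M (x, b)) ?xpair_eqE ?(negbTE xa) //.
have [x'a|x'a] := eqVneq x' a; first by rewrite x'a M0 M't /=; ring.
by rewrite M'M ?xpair_eqE ?(negbTE x'a) //=; ring.
Qed.

(** The change of the entry has mean zero, so the linear terms cancel. What remains is its variance,
    at most 1, for the pairs that involve row [a], of which there are at most [2 * N]. *)
Lemma codeg_energy_step M M1 M0 a b p : 0 <= p <= 1 ->
  (forall w, `|M w| <= 1) -> M (a, b) = 0 -> M1 (a, b) = 1 - p -> M0 (a, b) = - p ->
  (forall w, w != (a, b) -> M1 w = M w) -> (forall w, w != (a, b) -> M0 w = M w) ->
  p * codeg_energy M1 + (1 - p) * codeg_energy M0 <= codeg_energy M + 2 * N.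
Proof.
move=> /andP[p0 p1] M_1 Mab M1ab M0ab M1M M0M.
have sumeq : \sum_(w : V * V) ((w.1 == a)%:R + (w.2 == a)%:R) = 2 * N :> F.
  have E : \sum_(i : V) (i == a)%:R = 1 :> F.
    by rewrite (bigD1 a) //= eqxx big1 ?addr0 // => i /negbTE->.
  rewrite big_split /= -(pair_big predT predT (fun x y : V => (x == a)%:R : F)).
  rewrite -(pair_big predT predT (fun x y : V => (y == a)%:R : F)) /= E.
  under eq_bigr do rewrite sumr_const -[_ *+ #|_|]mulr_natl.
  by rewrite -mulr_sumr E !sumr_const; ring.
rewrite -sumeq.
apply: (@le_trans _ _ (codeg_energy M +
  \sum_(w : V * V | w.1 != w.2) ((w.1 == a)%:R + (w.2 == a)%:R))).
  rewrite /codeg_energy !mulr_sumr -!big_split; apply: ler_sum => -[x x'] /= xx'.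
  rewrite (codeg_upd Mab M1ab M1M xx') (codeg_upd Mab M0ab M0M xx').
  set c := (X in codeg M x x' + _ * X).
  have cc : c ^+ 2 <= (x == a)%:R + (x' == a)%:R.
    have sq1 w : M w ^+ 2 <= 1.
      by rewrite -[M w ^+ 2]real_normK ?num_real // expr_le1.
    rewrite /c; have [xa|_] := eqVneq x a.
      rewrite -xa eq_sym (negbTE xx') mul0r mul1r !addr0; exact: sq1.
    case: eqP => _; rewrite ?mul0r ?mul1r !add0r ?expr0n //; exact: sq1.
  have pp : p * (1 - p) <= 1 by nra.
  have c0 := sqr_ge0 c; have := ler_wpM2r c0 pp; rewrite mul1r => c1.
  have -> : p * (codeg M x x' + (1 - p) * c) ^+ 2 + (1 - p) * (codeg M x x' + - p * c) ^+ 2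
      = codeg M x x' ^+ 2 + p * (1 - p) * c ^+ 2 by ring.
  by rewrite lerD2l; apply: le_trans c1 cc.
rewrite lerD2l [leRHS](bigID (fun w => w.1 != w.2)) /= lerDl.
by apply: sumr_ge0 => w _; rewrite addr_ge0 ?ler0n.
Qed.

(** Cauchy-Schwarz is applied twice, to remove [T] and then [S]. The diagonal codegrees, absent from
    [codeg_energy], contribute at most [N ^ 3]. *)
Lemma cut_norm_le M (S T : {set V}) : (forall w, `|M w| <= 1) ->
  (\sum_(x in S) \sum_(y in T) M (x, y)) ^+ 4 <=
  N ^+ 4 * (codeg_energy M + N ^+ 3).
Proof.
move=> M1; set X := \sum_(x in S) _.
pose r y := \sum_(x in S) M (x, y); pose W := \sum_y r y ^+ 2.
have X2 : X ^+ 2 <= N * W.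
  have -> : X = \sum_y (y \in T)%:R * r y.
    rewrite /X exchange_big /= big_mkcond; apply: eq_bigr => y _.
    by case: ifP; rewrite ?mul1r ?mul0r.
  apply: le_trans (sum_sqr_le _) _; apply: ler_wpM2l; first exact: ler0n.
  apply: ler_sum => y _; case: (y \in T); rewrite ?mul1r ?mul0r ?expr0n //.
  exact: sqr_ge0.
have WE : W = \sum_(w : V * V) ((w.1 \in S) && (w.2 \in S))%:R * codeg M w.1 w.2.
  rewrite -(sum_mem_pair (fun w => codeg M w.1 w.2)) /= /codeg.
  under [RHS]eq_bigr do rewrite exchange_big.
  rewrite exchange_big; apply: eq_bigr => y _ /=.
  rewrite expr2 mulr_suml; apply: eq_bigr => x _.
  by rewrite mulr_sumr.
have W2 : W ^+ 2 <= N ^+ 2 * \sum_(w : V * V) codeg M w.1 w.2 ^+ 2.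
  rewrite WE -natrX -mulnn -card_prod; apply: le_trans (sum_sqr_le _) _.
  apply: ler_wpM2l; first exact: ler0n.
  apply: ler_sum => w _; case: (_ && _); rewrite ?mul1r ?mul0r ?expr0n //.
  exact: sqr_ge0.
have W3 : \sum_(w : V * V) codeg M w.1 w.2 ^+ 2 <= codeg_energy M + N ^+ 3.
  rewrite (bigID (fun w => w.1 != w.2)) /= lerD2l.
  have -> : N ^+ 3 = \sum_(x : V) N ^+ 2.
    by rewrite sumr_const -[RHS]mulr_natl -exprS.
  rewrite (eq_bigl (fun w : V * V => w.2 == w.1)); last first.
    by move=> w; rewrite negbK eq_sym.
  rewrite -(pair_big_dep predT (fun x y : V => y == x)
    (fun x y => codeg M x y ^+ 2)) /=.
  apply: ler_sum => x _; rewrite big_pred1_eq.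
  rewrite -real_normK ?num_real //; apply: lerXn2r; rewrite ?nnegrE ?ler0n //.
  apply: le_trans (ler_norm_sum _ _ _) _.
  rewrite -[N]mulr1 mulr_natl -sumr_const; apply: ler_sum => y _.
  by rewrite normrM mulr_ile1.
have N0 : 0 <= N by apply: ler0n.
have W0 : 0 <= W by apply: sumr_ge0 => y _; apply: sqr_ge0.
rewrite (_ : X ^+ 4 = (X ^+ 2) ^+ 2); last by rewrite -exprM.
apply: (@le_trans _ _ ((N * W) ^+ 2)).
  by apply: lerXn2r; rewrite ?nnegrE ?sqr_ge0 ?mulr_ge0.
rewrite exprMn (_ : N ^+ 4 = N ^+ 2 * N ^+ 2); last by rewrite -exprD.
rewrite -mulrA.
apply: ler_wpM2l; first exact: sqr_ge0.
apply: le_trans W2 _; apply: ler_wpM2l; first exact: sqr_ge0.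
exact: W3.
Qed.

(** Conditional expectations control a single quantity, so energy and edits share one potential,
    with exchange rate [mu]. The energy starts at 0 and gains at most [2 * N] at each of at most
    [N ^ 2] coordinates. *)
Lemma rounding f (G : V * V -> bool) (D : {set V * V}) (mu : F) :
  (forall w, 0 <= f w <= 1) -> (forall w, w \notin D -> f w = 0) -> 0 <= mu ->
  exists h : V * V -> bool,
    [/\ forall w, w \notin D -> h w = false &
    codeg_energy (fun w => (h w)%:R - f w) + mu * #|[set w in D | h w != G w]|%:R <=
    mu * \sum_(w in D) `|f w - (G w)%:R| + 2 * N ^+ 3].
Proof.
move=> f01 fD mu0.
(* On [[0, 1]] this is the distance from [u] to [G w], written affinely so that its mean is
   preserved exactly. *)
pose loss w (u : F) := if G w then 1 - u else u.
pose cost h := \sum_(w in D) loss w (h w).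
pose Phi h := codeg_energy (fun w => h w - f w) + mu * cost h.
have [|h [h01 hs hns Hh]] :=
  @round_coordinates (V * V)%type f Phi (2 * N) (enum D) (enum_uniq _) f01.
  move=> h [a b] abD h01 hab; rewrite /Phi.
  have f01ab := f01 (a, b); have /andP[fab0 fab1] := f01ab.
  have Hc : f (a, b) * cost (upd h (a, b) 1) + (1 - f (a, b)) * cost (upd h (a, b) 0) = cost h.
    rewrite /cost !mulr_sumr -big_split; apply: eq_bigr => w _ /=.
    rewrite /upd /loss; case: eqP => [->|_]; last by case: (G w); ring.
    by rewrite hab; case: (G _); ring.
  have := @codeg_energy_step (fun w => h w - f w) (fun w => upd h (a, b) 1 w - f w)
    (fun w => upd h (a, b) 0 w - f w) a b (f (a, b)) f01ab _ _ _ _ _ _.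
  have updE u w : w != (a, b) -> upd h (a, b) u w - f w = h w - f w.
    by rewrite /upd => /negbTE->.
  have H1 w : `|h w - f w| <= 1.
    have := h01 w; have := f01 w => /andP[? ?] /andP[? ?].
    by rewrite ler_norml; lra.
  move=> /(_ H1); rewrite hab subrr /upd eqxx sub0r.
  move=> /(_ erefl erefl erefl (updE 1) (updE 0)).
  rewrite -/(upd h (a, b) 1) -/(upd h (a, b) 0) -Hc; lra.
exists (fun w => h w == 1).
have hE w : (h w == 1)%:R = h w.
  have [wD|wD] := boolP (w \in D); last first.
    by rewrite hns ?mem_enum // fD // eq_sym oner_eq0.
  have we : w \in enum D by rewrite mem_enum.
  have [->|->] := hs w we; rewrite ?eqxx //.
  by rewrite eq_sym oner_eq0.
split=> [w wD|]; first by rewrite hns ?mem_enum // fD // eq_sym oner_eq0.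
pose h' w := h w == 1; rewrite -[fun w => (h w == 1)%:R - f w]/(fun w => (h' w)%:R - f w); have cE : cost h = #|[set w in D | h' w != G w]|%:R.
  rewrite /cost -sum1_card natr_sum [RHS](eq_bigl (fun w => (w \in D) && (h' w != G w))).
    rewrite big_mkcondr; apply: eq_bigr => w _; rewrite /loss -hE /h'.
    by case: (G w); case: (h w == 1); rewrite ?subr0 ?subrr.
  by move=> w; rewrite inE.
have cf : cost f = \sum_(w in D) `|f w - (G w)%:R|.
  apply: eq_bigr => w _; rewrite /loss; have /andP[f0 f1] := f01 w.
  case: (G w); last by rewrite subr0 ger0_norm.
  by rewrite distrC ger0_norm ?subr_ge0.
have E0 : codeg_energy (fun w => f w - f w) = 0.
  rewrite /codeg_energy big1 // => w _; rewrite /codeg big1 ?expr0n // => y _.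
  by rewrite subrr mul0r.
have sz : (size (enum D))%:R <= N ^+ 2.
  by rewrite -cardE -natrX -mulnn -card_prod ler_nat max_card.
have EE : codeg_energy (fun w => (h' w)%:R - f w) = codeg_energy (fun w => h w - f w).
  apply: eq_bigr => w _; congr (_ ^+ 2); apply: eq_bigr => y _.
  by rewrite /h' !hE.
rewrite EE -cE -cf; apply: le_trans Hh _; rewrite /Phi E0 add0r lerD2l.
rewrite exprS mulrA; apply: ler_wpM2l => //; by rewrite mulr_ge0.
Qed.
End Rounding.

(** * Equitable refinements *)

Section Chunks.
Variables (V K : finType) (kappa : V -> K).
Implicit Types (W Z : {set V}) (Q : {set {set V}}).

Definition mono Z := [forall x in Z, forall y in Z, kappa x == kappa y].

Lemma monoP Z x y : mono Z -> x \in Z -> y \in Z -> kappa x = kappa y.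
Proof. by move=> /forall_inP mZ xZ yZ; apply/eqP; have /forall_inP := mZ x xZ; apply. Qed.

Lemma exists_subset_card W h : h <= #|W| -> exists2 Z : {set V}, Z \subset W & #|Z| = h.
Proof.
move=> /card_geqP[s [us ss sW]]; exists [set x in s].
  by apply/subsetP => x; rewrite inE; apply: sW.
by rewrite cardsE -ss; apply/card_uniqP.
Qed.

(* As long as some colour class meets [W] in enough points, cut a
   monochromatic chunk out of it; afterwards at most [#|K|] chunks remain. *)
Lemma chunk_partition W r q t : #|W| = r * q + t -> t <= r -> 0 < q ->
  exists Q, [/\ partition Q W, #|Q| = r, forall Z, Z \in Q -> q <= #|Z| <= q.+1
    & #|[set Z in Q | ~~ mono Z]| <= #|K|].
Proof.
elim: r W t => [|r IH] W t cW tr q0.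
  exists set0; split; rewrite ?cards0 //; last 2 first.
  - by move=> Z; rewrite inE.
  - by rewrite (_ : [set Z in _ | _] = set0) ?cards0 //; apply/setP => Z; rewrite !inE.
  have /eqP : #|W| = 0 by lia.
  by rewrite cards_eq0 => /eqP->; rewrite partition_set0.
(* Chunks of size [q.+1] are cut as long as the surplus [t] lasts. *)
pose h := q + (0 < t).
have step Z : Z \subset W -> #|Z| = h -> exists Q, [/\ partition (Z |: Q) W, Z \notin Q,
    #|Q| = r, forall Z', Z' \in Q -> q <= #|Z'| <= q.+1
    & #|[set Z' in Q | ~~ mono Z']| <= #|K|].
  move=> ZW cZ; have [||//|Q [pQ cQ sQ mQ]] := IH (W :\: Z) (t - (0 < t)).
  - have -> : #|W :\: Z| = #|W| - #|Z| by rewrite cardsD (setIidPr ZW).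
    by rewrite cZ cW /h; case: (t) => [|t'] /=; lia.
  - by case: (t) tr => [|t'] /=; lia.
  have Z0 : Z != set0 by rewrite -cards_eq0 cZ /h; lia.
  have ZQ : Z \notin Q.
    apply/negP => ZQ; have := partitionS pQ ZQ.
    rewrite subsetD -setI_eq0 setIid => /andP[_ /eqP Z00].
    by rewrite Z00 eqxx in Z0.
  exists Q; split=> //; rewrite -(setID W Z) (setIidPr ZW).
  apply: partitionU1 => //; rewrite -setI_eq0; apply/eqP/setP => x.
  by rewrite !inE; case: (x \in Z).
have sizes Z Q : #|Z| = h -> (forall Z', Z' \in Q -> q <= #|Z'| <= q.+1) ->
    forall Z', Z' \in Z |: Q -> q <= #|Z'| <= q.+1.
  by move=> cZ sQ Z'; rewrite in_setU1 => /orP[/eqP->|/sQ//]; rewrite cZ /h; lia.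
(* If every class met [W] in fewer than [h] points, hence in at most [q], then [#|W| <= #|K| * q],
   while [W] has at least [r.+1 * q] points. *)
have [[a Ha]|small] : (exists a, h <= #|W :&: kappa @^-1: [set a]|) \/
    (r < #|K|).
  have [/existsP[a]|] := boolP [exists a, h <= #|W :&: kappa @^-1: [set a]|].
    by left; exists a.
  rewrite negb_exists => /forallP H; right.
  have : #|W| <= #|K| * q.
    rewrite -sum1_card (partition_big kappa predT) //= -sum_nat_const.
    apply: leq_sum => a _; have := H a; rewrite -ltnNge /h => Ha.
    rewrite sum1dep_card; suff : #|W :&: kappa @^-1: [set a]| <= q.
      by apply: leq_trans; apply: eq_leq; apply: eq_card => x; rewrite !inE.
    by move: Ha; case: (t) => [|t'] /=; lia.
  nia.
  have [Z ZW cZ] := exists_subset_card Ha.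
  have [|Q [pQ ZQ cQ sQ mQ]] := step Z _ cZ; first exact: subset_trans ZW (subsetIl _ _).
  exists (Z |: Q); split=> //; [by rewrite cardsU1 ZQ cQ | exact: sizes |].
  apply: leq_trans mQ; apply/subset_leq_card/subsetP => Z'; rewrite !inE.
  case: eqP => //= -> /negP[]; apply/forall_inP => x xZ; apply/forall_inP => y yZ.
  have := subsetP ZW x xZ; have := subsetP ZW y yZ; rewrite !inE.
  by move=> /andP[_ /eqP->] /andP[_ /eqP->].
have [|Z ZW cZ] := @exists_subset_card W h; first by rewrite cW /h; nia.
have [Q [pQ ZQ cQ sQ mQ]] := step Z ZW cZ.
exists (Z |: Q); split=> //; [by rewrite cardsU1 ZQ cQ | exact: sizes |].
apply: leq_trans small; have <- : #|Z |: Q| = r.+1 by rewrite cardsU1 ZQ cQ.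
by apply/subset_leq_card/subsetP => Z'; rewrite inE => /andP[].
Qed.

Definition refining (P P0 : {set {set V}}) :=
  forall A, A \in P -> exists2 B, B \in P0 & A \subset B.

(** All parts are cut with the same quotient [s %/ r], which keeps chunks of different parts
    comparable. The exceptional chunks number at most [#|K|] per part whatever [r] is, so a large
    [r] makes them rare. *)
Lemma equitable_refinement (P0 : {set {set V}}) r s :
  partition P0 [set: V] -> (forall W, W \in P0 -> s <= #|W| <= s.+1) -> 0 < r <= s ->
  exists P, [/\ partition P [set: V] /\ refining P P0, #|P| = #|P0| * r,
    forall Z, Z \in P -> s %/ r <= #|Z| <= (s %/ r).+1
    & #|[set Z in P | ~~ mono Z]| <= #|P0| * #|K|].
Proof.
move=> pP0 sP0 /andP[r0 rs].
have q0 : 0 < s %/ r by rewrite divn_gt0.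
pose chunks W Q := [&& partition Q W, #|Q| == r,
  [forall Z in Q, s %/ r <= #|Z| <= (s %/ r).+1]
    & #|[set Z in Q | ~~ mono Z]| <= #|K|].
have /fin_all_exists[Q HQ] : forall W, exists Q, (W \in P0) ==> chunks W Q.
  move=> W.
  have [WP|_] := boolP (W \in P0); last by exists set0.
  have /andP[s1 s2] := sP0 W WP; have lt := ltn_pmod s r0.
  (* The surplus equals [r] when [s %% r = r - 1] and [#|W| = s.+1]; this is why [chunk_partition]
     allows [t <= r]. *)
  have [||//|Q [pQ cQ sQ mQ]] := @chunk_partition W r (s %/ r) (s %% r + (#|W| - s)).
  - by rewrite addnA mulnC -divn_eq; lia.
  - by lia.
  by exists Q; rewrite /chunks pQ cQ eqxx mQ andbT /=; apply/forall_inP.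
have {}HQ W : W \in P0 -> [/\ partition (Q W) W, #|Q W| = r,
    forall Z, Z \in Q W -> s %/ r <= #|Z| <= (s %/ r).+1
    & #|[set Z in Q W | ~~ mono Z]| <= #|K|].
  by move=> WP; have /and4P[] := implyP (HQ W) WP => ? /eqP ? /forall_inP ? ?.
have tP0 := partition_trivIset pP0.
have eqW W W' Z : W \in P0 -> W' \in P0 -> Z \in Q W -> Z \in Q W' -> W = W'.
  move=> WP WP' ZQ ZQ'; have [pW _ _ _] := HQ _ WP; have [pW' _ _ _] := HQ _ WP'.
  have /set0Pn[x xZ] := partition_neq0 pW ZQ.
  rewrite -(def_pblock tP0 WP (subsetP (partitionS pW ZQ) x xZ)).
  by rewrite -(def_pblock tP0 WP' (subsetP (partitionS pW' ZQ') x xZ)).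
have cnt (a : pred {set V}) : \sum_(Z in \bigcup_(W in P0) Q W) (a Z : nat) =
    \sum_(W in P0) \sum_(Z in Q W) (a Z : nat).
  rewrite (_ : \bigcup_(W in P0) Q W = \bigcup_W (if W \in P0 then Q W else set0));
    last exact: big_mkcond.
  rewrite partition_disjoint_bigcup; last first.
    move=> W W' WW'; rewrite -setI_eq0; apply/eqP/setP => Z; rewrite !inE.
    apply/negP; case: ifP => [WP|_]; last by rewrite inE.
    case: ifP => [WP'|_]; last by rewrite inE andbF.
    by move=> /andP[ZQ ZQ']; rewrite (eqW W W' Z) // eqxx in WW'.
  rewrite [RHS]big_mkcond; apply: eq_bigr => W _.
  by case: ifP => // _; rewrite big_set0.
exists (\bigcup_(W in P0) Q W); split.
- split; last first.
    move=> Z /bigcupP[W WP ZQ]; have [pW _ _ _] := HQ _ WP.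
    by exists W => //; apply: partitionS ZQ.
  apply/and3P; split.
  + apply/eqP/setP => x; rewrite inE; apply/bigcupP.
    have : x \in cover P0 by rewrite (cover_partition pP0) inE.
    case/bigcupP => W WP; have [pW _ _ _] := HQ _ WP.
    rewrite -(cover_partition pW) => /bigcupP[Z ZQ xZ].
    by exists Z => //; apply/bigcupP; exists W.
  + apply/trivIsetP => Z Z' /bigcupP[W WP ZQ] /bigcupP[W' WP' ZQ'] ZZ'.
    have [pW _ _ _] := HQ _ WP; have [pW' _ _ _] := HQ _ WP'.
    have [E|WW'] := eqVneq W W'.
      by subst W'; apply: (trivIsetP (partition_trivIset pW)).
    have dW := trivIsetP tP0 _ _ WP WP' WW'.
    exact: disjointWl (partitionS pW ZQ) (disjointWr (partitionS pW' ZQ') dW).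
  + apply/negP => /bigcupP[W WP]; have [pW _ _ _] := HQ _ WP.
    by rewrite (partition0 pW).
- have := cnt predT; rewrite sum1_card => ->; rewrite -sum_nat_const.
  by apply: eq_bigr => W WP; have [_ <- _ _] := HQ _ WP; rewrite sum1_card.
- by move=> Z /bigcupP[W WP]; have [_ _ + _] := HQ _ WP; apply.
have cntE (R : {set {set V}}) : \sum_(Z in R) (~~ mono Z : nat) = #|[set Z in R | ~~ mono Z]|.
  by rewrite -sum1dep_card big_mkcondr.
rewrite -cntE (cnt (fun Z => ~~ mono Z)) -sum_nat_const.
by apply: leq_sum => W WP; rewrite cntE; have [] := HQ _ WP.
Qed.
End Chunks.

(** * Entropy *)

Section Entropy.
Local Open Scope R_scope.

Lemma ln_le_sub1 (x : R) : 0 < x -> ln x <= x - 1.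
Proof. by move=> x0; have := exp_ineq1_le (ln x); rewrite exp_ln //; Lra.lra. Qed.

(** With [s] and [t] the roots of two densities, this is the bound of squared Hellinger distance by
    relative entropy; it follows from [ln (t / s) <= t / s - 1], multiplied by [2 * s * s]. *)
Lemma hellinger_le_divergence (s t : R) : 0 <= s -> 0 <= t -> (t = 0 -> s = 0) ->
  (s - t) * (s - t) <= s * s * (ln (s * s) - ln (t * t)) - s * s + t * t.
Proof.
move=> s0 t0 ts; have [s00|sn0] := Req_dec s 0; first by subst s; Lra.lra.
have sp : 0 < s by Lra.lra.
have tp : 0 < t by case: t0 => // t0; have := ts (esym t0); Lra.lra.
have H := ln_le_sub1 (Rdiv_lt_0_compat _ _ tp sp).
rewrite /Rdiv ln_mult ?ln_Rinv // in H; last exact: Rinv_0_lt_compat.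
rewrite !ln_mult //.
have := Rmult_le_compat_l (s * s) _ _ (Rle_0_sqr s) H.
rewrite (_ : s * s * (t * / s - 1) = s * t - s * s); last by field_simplify_eq.
Lra.nra.
Qed.

End Entropy.

Section EntropyIncrement.
Local Open Scope ring_scope.

Local Arguments ln x%_ring_scope.

(** The factor [x] gives the customary value [0] at [0], whatever [ln 0] is. *)
Definition xlnx (x : R) := x * ln x.
Local Arguments xlnx x%_ring_scope.

Lemma xlnx_le0 (x : R) : 0 <= x <= 1 -> xlnx x <= 0.
Proof.
move=> /andP[x0 x1]; rewrite /xlnx; have [->|xn0] := eqVneq x 0; first by rewrite mul0r.
have xp : 0 < x by rewrite lt_def xn0.
have : ln x <= 0.
  apply/RleP; have /RltP xp' := xp; have := ln_le_sub1 xp'.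
  by move: x1 => /RleP; rewrite /GRing.zero /GRing.one /=; Lra.lra.
by move=> h; rewrite pmulr_rle0.
Qed.

Lemma hellinger_le_divergence_sqrt (a b : R) : 0 <= a -> 0 <= b ->
  (b = 0 -> a = 0) ->
  (Num.sqrt a - Num.sqrt b) ^+ 2 <= a * (ln a - ln b) - a + b.
Proof.
move=> a0 b0 ba; rewrite -{2 3 4}(sqr_sqrtr a0) -{2 3}(sqr_sqrtr b0).
rewrite !expr2; apply/RleP; apply: hellinger_le_divergence.
- by apply/RleP; apply: sqrtr_ge0.
- by apply/RleP; apply: sqrtr_ge0.
move=> /eqP; rewrite sqrtr_eq0 => b0'.
by rewrite ba ?sqrtr0 //; apply/eqP; rewrite eq_le b0 b0'.
Qed.

Section Increment.
Variables (Om : finType) (L L' : eqType) (pi : Om -> L) (rho : Om -> L').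
Variable g : Om -> R.
Hypothesis ref : forall w v, rho w = rho v -> pi w = pi v.
Hypothesis g01 : forall w, 0 <= g w <= 1.

(** The entropy gain is a relative entropy: [ln (b w)] is constant on coarse blocks, where [a] and
    [b] have equal sums. Then [|a - b|] factors through square roots, Cauchy-Schwarz leaves the
    Hellinger distance, and [4] comes from bounding the square of [sqrt a + sqrt b] by
    [2 * a + 2 * b]. *)
Lemma sqr_dist_le_entropy :
  (\sum_w `|avg rho g w - avg pi g w|) ^+ 2 <=
  4 * (\sum_w g w) *
  (\sum_w xlnx (avg rho g w) - \sum_w xlnx (avg pi g w)).
Proof.
have g0 v : 0 <= g v by have /andP[] := g01 v.
set a := avg rho g; set b := avg pi g.
have a0 w : 0 <= a w by apply: avg_ge0.
have b0 w : 0 <= b w by apply: avg_ge0.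
have ba w : b w = 0 -> a w = 0.
  move=> bw; rewrite /a /avg big1 ?mul0r // => v /eqP /ref H.
  exact: (avg_eq0 g0 bw H).
have sa : \sum_w a w = \sum_w g w by apply: sum_avg1.
have sb : \sum_w b w = \sum_w g w by apply: sum_avg1.
have H1 : \sum_w ln (b w) * a w = \sum_w ln (b w) * b w.
  by apply: sum_avg_refine => // w v H; rewrite /b (avg_eq g H).
have -> : \sum_w xlnx (a w) - \sum_w xlnx (b w) =
   \sum_w (a w * (ln (a w) - ln (b w)) - a w + b w).
  rewrite big_split sumrB /= sa sb subrK.
  under [in RHS]eq_bigr do rewrite mulrBr.
  rewrite sumrB; congr (_ - _).
  under eq_bigr do rewrite /xlnx mulrC.
  by rewrite -H1; apply: eq_bigr => w _; rewrite mulrC.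
set D := (X in _ <= _ * X).
have HD : \sum_w `|Num.sqrt (a w) - Num.sqrt (b w)| ^+ 2 <= D.
  apply: ler_sum => w _; rewrite real_normK ?num_real //.
  exact: hellinger_le_divergence_sqrt (a0 w) (b0 w) (@ba w).
have E w : `|a w - b w| =
    `|Num.sqrt (a w) - Num.sqrt (b w)| * (Num.sqrt (a w) + Num.sqrt (b w)).
  rewrite -[X in _ * X]ger0_norm ?addr_ge0 ?sqrtr_ge0 // -normrM -subr_sqr.
  by rewrite !sqr_sqrtr.
under eq_bigr do rewrite E.
apply: le_trans (cauchy_schwarz _ _) _.
rewrite mulrC; apply: ler_pM => //.
- by apply: sumr_ge0 => w _; apply: sqr_ge0.
- by apply: sumr_ge0 => w _; apply: sqr_ge0.
have -> : 4 * \sum_w g w = \sum_w (2 * a w + 2 * b w).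
  by rewrite big_split -!mulr_sumr /= sa sb; ring.
apply: ler_sum => w _; rewrite -{2}(sqr_sqrtr (a0 w)) -{2}(sqr_sqrtr (b0 w)).
have := sqr_ge0 (Num.sqrt (a w) - Num.sqrt (b w)); nra.
Qed.

End Increment.

(** * Iteration up to a stable pair of colourings *)

Section Iteration.
Variables (V : finType) (g : V * V -> R).
Hypothesis g01 : forall w, 0 <= g w <= 1.
Variables (eta : nat -> R) (J : nat -> nat).
Hypothesis eta0 : forall k, 0 < eta k.
Hypothesis J_eta : forall k, 1 < (J k)%:R * eta k ^+ 2.
Hypothesis J_mono : forall k l, (k <= l)%N -> (J k <= J l)%N.

Definition wr_step (k : nat) : nat := (k * 4 ^ J k)%N.

Lemma wr_step_mono k l : (k <= l)%N -> (wr_step k <= wr_step l)%N.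
Proof. by move=> kl; rewrite leq_mul // leq_exp2l // J_mono. Qed.

Lemma iter_wr_step_mono T k l : (k <= l)%N ->
  (iter T wr_step k <= iter T wr_step l)%N.
Proof. by move=> kl; elim: T => //= T; apply: wr_step_mono. Qed.

Lemma leq_wr_step k : (k <= wr_step k)%N.
Proof. by rewrite /wr_step leq_pmulr ?expn_gt0. Qed.

(** Each unstable step raises the entropy by more than [d ^ 2 * s / 4], and by the last hypothesis
    [T] such steps exhaust the gap from the one-class colouring to [0]. No bound on [K'] is kept, as
    the finer colouring only defines the damped graph. *)
Lemma stable_refinement (d : R) (T : nat) :
  0 < \sum_w g w -> 0 <= d ->
  - (T%:R * d ^+ 2 / 4) <= ln ((\sum_w g w) / #|V|%:R ^+ 2) ->
  exists (K K' : finType) (kappa : V -> K) (kappa' : V -> K'),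
    [/\ forall x y, kappa' x = kappa' y -> kappa x = kappa y,
        (#|K| <= iter T wr_step 1)%N,
        weakly_regular kappa kappa' g (eta #|K|) &
        \sum_w `|pavg kappa' g w - pavg kappa g w| <= d * \sum_w g w].
Proof.
set s := \sum_w g w => s0 d0 HT.
have g0 v : 0 <= g v by have /andP[] := g01 v.
have g1 v : g v <= 1 by have /andP[] := g01 v.
pose ent (K : finType) (k : V -> K) := \sum_w xlnx (pavg k g w).
have ent_le0 (K : finType) (k : V -> K) : ent K k <= 0.
  rewrite -oppr_ge0 -sumrN; apply: sumr_ge0 => w _; rewrite oppr_ge0.
  by apply: xlnx_le0; rewrite avg_ge0 // avg_le1.
have incr (K1 K2 : finType) (k1 : V -> K1) (k2 : V -> K2) :
    (forall x y, k2 x = k2 y -> k1 x = k1 y) ->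
    d * s < \sum_w `|pavg k2 g w - pavg k1 g w| ->
    d ^+ 2 * s / 4 < ent K2 k2 - ent K1 k1.
  move=> ref big.
  have ref' w v : pcol k2 w = pcol k2 v -> pcol k1 w = pcol k1 v.
    by rewrite /pcol => -[/ref-> /ref->].
  have H := sqr_dist_le_entropy ref' g01.
  have : (d * s) ^+ 2 < 4 * s * (ent K2 k2 - ent K1 k1).
    by apply: lt_le_trans H; rewrite ltr_pXn2r ?nnegrE ?mulr_ge0 ?(ltW s0) ?sumr_ge0.
  have -> : (d * s) ^+ 2 = (4 * s) * (d ^+ 2 * s / 4) by field.
  by rewrite ltr_pM2l // mulr_gt0.
have main t (K1 : finType) (k1 : V -> K1) : 
    0 <= ent K1 k1 + t%:R * (d ^+ 2 * s / 4) ->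
  exists (K K' : finType) (kappa : V -> K) (kappa' : V -> K'),
    [/\ forall x y, kappa' x = kappa' y -> kappa x = kappa y,
        (#|K| <= iter t wr_step #|K1|)%N,
        weakly_regular kappa kappa' g (eta #|K|) &
        \sum_w `|pavg kappa' g w - pavg kappa g w| <= d * s].
  elim: t K1 k1 => [|t IH] K1 k1 Hent;
    have [K2 [k2 [ref2 c2 wr2]]] := weak_regularity k1 g01 (eta0 #|K1|) (J_eta #|K1|);
    have [small|big] := lerP (\sum_w `|pavg k2 g w - pavg k1 g w|) (d * s).
  - by exists K1, K2, k1, k2.
  - have := incr _ _ k1 k2 ref2 big; have := ent_le0 _ k2.
    have : 0 <= d ^+ 2 * s / 4 by rewrite divr_ge0 // mulr_ge0 ?sqr_ge0 ?ltW.
    by move: Hent; rewrite mul0r; lra.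
  - exists K1, K2, k1, k2; split=> //; apply: leq_trans (leq_wr_step _) _.
    by rewrite iterSr; elim: (t) => //= i Hi; apply: leq_trans Hi (leq_wr_step _).
  have Hinc := incr _ _ k1 k2 ref2 big.
  have [|K [K' [k [k' [r' c wr sm]]]]] := IH K2 k2.
    by move: Hent; rewrite mulrS mulrDl mul1r; lra.
  exists K, K', k, k'; split=> //; apply: leq_trans c _.
  by rewrite iterSr iter_wr_step_mono.
have := main T unit (fun=> tt); rewrite card_unit; apply.
have V0 : #|V|%:R != 0 :> R.
  apply: contraTneq s0 => V0; rewrite /s big1 ?ltxx // => w _.
  move: V0 => /eqP; rewrite pnatr_eq0 => /eqP /card0_eq /(_ w.1).
  by rewrite inE.
(* With one class every block average is the overall density [s / #|V| ^ 2]. *)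
have -> : ent unit (fun=> tt) = s * ln (s / #|V|%:R ^+ 2).
  rewrite /ent (eq_bigr (fun=> xlnx (s / #|V|%:R ^+ 2))) => [|w _].
    by rewrite sumr_const card_prod -[LHS]mulr_natr natrM /xlnx; field.
  congr xlnx; rewrite /pavg /avg; under eq_bigl do rewrite eqxx.
  rewrite -/s; congr (s / _); rewrite -natrX -mulnn -card_prod.
  by congr (_%:R); apply: eq_card => v; rewrite !inE eqxx.
have : - (T%:R * (d ^+ 2 * s / 4)) <= s * ln (s / #|V|%:R ^+ 2).
  have -> : - (T%:R * (d ^+ 2 * s / 4)) = s * - (T%:R * d ^+ 2 / 4) by field.
  by rewrite ler_pM2l.
lra.
Qed.


End Iteration.
End EntropyIncrement.

(** * Graphs *)

Section Graphs.
Local Open Scope ring_scope.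
Variable n : nat.
Implicit Types (E : graph n) (A B : {set 'I_n}).

Definition adj E (w : 'I_n * 'I_n) := [set w.1; w.2] \in E.

Lemma adj_sym E x y : adj E (x, y) = adj E (y, x).
Proof. by rewrite /adj /= setUC. Qed.

Lemma adj_irrefl E x : is_graph E -> adj E (x, x) = false.
Proof.
move=> gE; apply/negP; rewrite /adj /= setUid => /gE.
by rewrite cards1.
Qed.

Lemma eq_set2 (T : finType) (x y a b : T) : a != b ->
  ([set x; y] == [set a; b]) = ((x, y) == (a, b)) || ((x, y) == (b, a)).
Proof.
move=> ab; rewrite !xpair_eqE; apply/eqP/idP => [H|]; last first.
  by case/orP=> /andP[/eqP-> /eqP->] //; rewrite setUC.
have Ha : a \in [set x; y] by rewrite H set21.
have Hb : b \in [set x; y] by rewrite H set22.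
have : x \in [set a; b] by rewrite -H set21.
move: Ha Hb; rewrite !inE => + + /orP[]/eqP Ex; rewrite {}Ex ?eqxx.
  by rewrite eq_sym (eq_sym b) (negbTE ab) /= eq_sym => _ ->.
by rewrite (negbTE ab) /= eq_sym => -> _; rewrite orbT.
Qed.

Lemma e_G_sum (F : realFieldType) E A B :
  (e_G E A B)%:R = \sum_(x in A) \sum_(y in B) (adj E (x, y))%:R :> F.
Proof.
rewrite (sum_mem_pair (fun w => (adj E w)%:R : F)) /e_G -sum1dep_card natr_sum.
rewrite big_mkcond; apply: eq_bigr => w _; rewrite /adj.
by case: (_ \in A); case: (_ \in B); case: (_ \in E); rewrite ?mul1r ?mul0r.
Qed.

Lemma card_adj E : is_graph E -> #|[set w | adj E w]| = (2 * nedges E)%N.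
Proof.
move=> gE; rewrite -sum1dep_card.
rewrite (partition_big (fun w : 'I_n * 'I_n => [set w.1; w.2]) (mem E)) //=.
rewrite (eq_bigr (fun=> 2%N)) ?sum_nat_const 1?mulnC // => e eE.
have /eqP/cards2P[a [b [ab Ee]]] := gE e eE; rewrite Ee in eE *.
rewrite sum1dep_card (_ : [set _ | _] = [set (a, b); (b, a)]).
  by rewrite cards2 xpair_eqE (negbTE ab).
apply/setP => -[x y]; rewrite !inE -eq_set2 //= /adj /=.
by case: eqP => [->|_]; rewrite ?andbF ?eE.
Qed.

(** Only entries above the diagonal are read, so every [h] yields a simple graph. *)
Definition graph_of (h : 'I_n * 'I_n -> bool) : graph n :=
  [set [set w.1; w.2] | w in [set w : 'I_n * 'I_n | (w.1 < w.2)%N && h w]].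

Lemma graph_of_is_graph h : is_graph (graph_of h).
Proof.
move=> e /imsetP[[x y]]; rewrite inE /= => /andP[xy _] ->.
by rewrite cards2 -(inj_eq val_inj) (ltn_eqF xy).
Qed.

Lemma adj_graph_of h x y : adj (graph_of h) (x, y) =
  if (x < y)%N then h (x, y) else if (y < x)%N then h (y, x) else false.
Proof.
have lt (a b : 'I_n) : (a < b)%N -> adj (graph_of h) (a, b) = h (a, b).
  move=> ab; apply/imsetP/idP => [[[c d]]|hab]; last by exists (a, b); rewrite ?inE ?ab.
  rewrite inE /= => /andP[cd hcd] /eqP.
  rewrite eq_set2; last by rewrite -(inj_eq val_inj) (ltn_eqF cd).
  case/orP=> /eqP[Ea Eb]; first by rewrite Ea Eb.
  by move: ab; rewrite Ea Eb ltnNge ltnW.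
case: ltngtP => [/lt//|/lt <-|/val_inj->]; first by rewrite adj_sym.
exact: adj_irrefl (@graph_of_is_graph h).
Qed.

Lemma card_symdiff_graph_of E h : is_graph E ->
  (#|(E :\: graph_of h) :|: (graph_of h :\: E)| <=
   #|[set w in [set w : 'I_n * 'I_n | (w.1 < w.2)%N] | h w != adj E w]|)%N.
Proof.
move=> gE; set D := [set w in _ | _].
apply: leq_trans (leq_imset_card (fun w : 'I_n * 'I_n => [set w.1; w.2]) D).
apply/subset_leq_card/subsetP => e He.
have /eqP/cards2P[a [b [ab Ee]]] : #|e| = 2%N.
  by move: He; rewrite !inE => /orP[]/andP[_]; [apply: gE | apply: graph_of_is_graph].
have main (x y : 'I_n) : (x < y)%N -> e = [set x; y] -> e \in [set [set w.1; w.2] | w in D].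
  move=> xy Exy; apply/imsetP; exists (x, y) => //; rewrite !inE /= xy /=.
  have := adj_graph_of h x y; rewrite xy => <-.
  by move: He; rewrite !inE /adj /= -Exy; case: (e \in E); case: (e \in _).
have := ab; rewrite -(inj_eq val_inj) neq_ltn => /orP[/main|/main]; first exact.
by rewrite setUC; apply.
Qed.

End Graphs.

(** * Regularizing a graph *)

Section Regularization.
Local Open Scope ring_scope.
Local Arguments ln x%_ring_scope.

Lemma ler_ln (x y : R) : 0 < x -> x <= y -> ln x <= ln y.
Proof.
move=> x0; rewrite le_eqVlt => /orP[/eqP->//|xy]; apply: ltW.
by apply/RltP; apply: ln_increasing; apply/RltP.
Qed.

Lemma pavg_sym (F : realFieldType) (V : finType) (K : eqType) (kappa : V -> K)
    (g : V * V -> F) x y : (forall x y, g (x, y) = g (y, x)) ->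
  pavg kappa g (x, y) = pavg kappa g (y, x).
Proof.
move=> gs; pose sw (w : V * V) := (w.2, w.1).
have swK : involutive sw by case.
have E w z z' : (pcol kappa (sw w) == pcol kappa (z, z')) = (pcol kappa w == pcol kappa (z', z)).
  by rewrite /pcol !xpair_eqE andbC.
rewrite /pavg /avg; congr (_ / _).
  rewrite (reindex_inj (inv_inj swK)) /=.
  by apply: eq_big => [w|[a b] _]; [apply: E | apply: gs].
congr (_%:R); rewrite -!sum1_card (reindex_inj (inv_inj swK)) /=.
by apply: eq_bigl => w; rewrite !inE; apply: E.
Qed.

Definition adjR (F : realFieldType) n (E : graph n) (w : 'I_n * 'I_n) : F :=
  (adj E w)%:R.

Lemma adjR_ge0_le1 (F : realFieldType) n (E : graph n) w : 0 <= adjR F E w <= 1.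
Proof. by rewrite /adjR; case: (adj E w); rewrite ?lexx ?ler01. Qed.

Lemma sum_adjR (F : realFieldType) n (E : graph n) : is_graph E ->
  \sum_w adjR F E w = 2 * (nedges E)%:R.
Proof.
move=> gE; rewrite -natrM -card_adj // -sum1dep_card natr_sum [RHS]big_mkcond.
by apply: eq_bigr => w _; rewrite /adjR; case: (adj E w).
Qed.

(** The edit budget is halved between damping, where [delta / 4] of the weight [2|E|] is [delta / 2]
    of [|E|], and rounding. The final [4] counts four errors of size [n ^ 2 / D]: rounding above and
    below the diagonal, the diagonal itself, and weak regularity. *)
Lemma regularized_graph_of_stable (F : realFieldType) n (E : graph n)
    (K K' : finType) (k : 'I_n -> K) (k' : 'I_n -> K') (D A : nat) (delta p : F) :
  is_graph E -> (forall x y, k' x = k' y -> k x = k y) ->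
  weakly_regular k k' (adjR F E) D%:R^-1 ->
  \sum_w `|pavg k' (adjR F E) w - pavg k (adjR F E) w| <=
    delta / 4 * \sum_w adjR F E w ->
  0 < delta -> 0 < p -> p * n%:R ^+ 2 <= 2 * (nedges E)%:R ->
  (delta * p)^-1 <= A%:R -> (0 < D)%N -> (16 * D ^ 4 * A < n)%N ->
  exists E' : graph n,
  [/\ is_graph E', #|(E :\: E') :|: (E' :\: E)|%:R <= delta * (nedges E)%:R &
    forall Z Z' : {set 'I_n}, mono k Z -> mono k Z' ->
    exists c : F, forall A' B' : {set 'I_n}, A' \subset Z -> B' \subset Z' ->
    `|(e_G E' A' B')%:R - c * (#|A'|%:R * #|B'|%:R)| <= 4 / D%:R * n%:R ^+ 2].
Proof.
move=> gE rk' wr sm d0 p0 Hp HA D0 Hn; set g := adjR F E in wr sm.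
have g01 w : 0 <= g w <= 1 by apply: adjR_ge0_le1.
have sg : \sum_w g w = 2 * (nedges E)%:R by apply: sum_adjR.
have A0 : (0 < A)%N.
  by rewrite -(ltr0n F); apply: lt_le_trans HA; rewrite invr_gt0 mulr_gt0.
have n0 : 0 < n%:R :> F by rewrite ltr0n; apply: leq_ltn_trans Hn.
pose d4 := delta / 4; rewrite -/d4 in sm.
set d : F := D%:R in wr *.
have dpos : 0 < d by rewrite ltr0n.
have dn0 : d != 0 by rewrite gt_eqF.
set N : F := n%:R in Hp n0 *.
have Hnd : 16 * d ^+ 4 * A%:R < N by rewrite /d /N -natrX -!natrM ltr_nat.
pose f w := transfer (pavg k g w) (pavg k' g w) (g w).
have avg01 (L : eqType) (c : 'I_n -> L) w : 0 <= pavg c g w <= 1.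
  by rewrite avg_ge0 ?avg_le1 // => v; have /andP[] := g01 v.
have refp w v : pcol k' w = pcol k' v -> pcol k w = pcol k v.
  by rewrite /pcol => -[/rk'-> /rk'->].
have f01 w : 0 <= f w <= 1.
  have g0 v : 0 <= g v by have /andP[] := g01 v.
  by apply: transfer_ge0_le1 => // H; apply: (avg_eq0 g0 H).
have fs x y : f (x, y) = f (y, x).
  have gs a b : g (a, b) = g (b, a) by rewrite /g /adjR adj_sym.
  by rewrite /f (pavg_sym k x y gs) (pavg_sym k' x y gs) gs.
(* Only the entries above the diagonal are rounded, so that they can be chosen
   independently of each other. *)
pose Dg := [set w : 'I_n * 'I_n | (w.1 < w.2)%N].
pose f' w := if w \in Dg then f w else 0.
have f'01 w : 0 <= f' w <= 1 by rewrite /f'; case: ifP; rewrite ?lexx ?ler01.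
(* With this rate even [N ^ 2] edits use only half of the allowance [(N / d) ^ 4] for the energy,
   and the error [2 * N ^ 3] of the rounding costs only [4 * N * d ^ 4] further edits. *)
pose mu := d ^- 4 / 2 * N ^+ 2.
have mu0 : 0 < mu by rewrite /mu mulr_gt0 ?exprn_gt0 // divr_gt0 ?invr_gt0 ?exprn_gt0.
have [||h [hD Hh]] := @rounding _ _ f' (adj E) Dg mu f'01.
- by move=> w /negbTE wD; rewrite /f' wD.
- exact: ltW.
rewrite card_ord -/N in Hh.
have d1' : 1 <= d by rewrite ler1n.
have A1 : 1 <= A%:R :> F by rewrite ler1n.
have d4pos : 0 < d ^+ 4 by rewrite exprn_gt0.
have Nd4 : 16 * d ^+ 4 <= N.
  by apply: ltW; apply: le_lt_trans Hnd; rewrite ler_peMr // mulr_ge0 // ltW.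
have d_le_d4 : d <= d ^+ 4 by rewrite -[leLHS]expr1 ler_weXn2l.
have Hcodeg : codeg_energy (fun w => (h w)%:R - f' w) + N ^+ 3 <= (N / d) ^+ 4.
  have HY : \sum_(w in Dg) `|f' w - (adj E w)%:R| <= N ^+ 2.
    have -> : N ^+ 2 = \sum_(w : 'I_n * 'I_n) 1.
      by rewrite sumr_const card_prod card_ord natrM.
    rewrite big_mkcond; apply: ler_sum => w _; case: ifP => // _.
    have /andP[? ?] := f'01 w; have /andP[] := g01 w; rewrite /g /adjR => ? ?.
    by rewrite ler_norml; apply/andP; split; lra.
  have H1 : 0 <= mu * #|[set w in Dg | h w != adj E w]|%:R by rewrite mulr_ge0 // ltW.
  have H2 := ler_wpM2l (ltW mu0) HY.
  have -> : (N / d) ^+ 4 = mu * N ^+ 2 + (d ^- 4 / 2) * N ^+ 4.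
    by rewrite /mu; field.
  suff : 3 * N ^+ 3 <= d ^- 4 / 2 * N ^+ 4 by lra.
  have H3 : 3 <= d ^- 4 / 2 * N.
    have := ler_wpM2l (ltW (etrans (invr_gt0 _) d4pos)) Nd4.
    rewrite mulrCA mulVf ?gt_eqF //; lra.
  have -> : d ^- 4 / 2 * N ^+ 4 = d ^- 4 / 2 * N * N ^+ 3 by ring.
  by apply: ler_wpM2r H3; rewrite exprn_ge0 // ltW.
exists (graph_of h); split=> //.
- exact: graph_of_is_graph.
- have H1 : codeg_energy (fun w => (h w)%:R - f' w) >= 0.
    by apply: sumr_ge0 => w _; apply: sqr_ge0.
  have := card_symdiff_graph_of h gE; rewrite -(ler_nat F).
  set X := #|[set w in _ | _]|%:R in Hh *.
  set Y := \sum_(w in Dg) _ in Hh.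
  have HX : mu * X <= mu * (Y + 4 * N * d ^+ 4).
    have -> : mu * (Y + 4 * N * d ^+ 4) = mu * Y + 2 * N ^+ 3 by rewrite /mu; field.
    by apply: le_trans Hh; rewrite lerDr.
  rewrite ler_pM2l // in HX.
  move=> /le_trans; apply; apply: le_trans HX _.
  have HY : Y <= d4 * (2 * (nedges E)%:R).
    rewrite -sg; apply: le_trans sm; rewrite -(sum_transfer_dist refp g01) /Y.
    rewrite [leRHS](bigID (mem Dg)) /= -[leLHS]addr0; apply: lerD.
      by rewrite le_eqVlt; apply/orP; left; apply/eqP; apply: eq_bigr => w wD; rewrite /f' wD.
    by apply: sumr_ge0.
  (* Here the lower bound on [n] enters: [A] dominates [1 / (delta * p)], so
     [16 * d ^ 4 <= N * (delta * p)]. *)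
  have HE : 4 * N * d ^+ 4 <= delta / 2 * (nedges E)%:R.
    have HA' : 16 * d ^+ 4 <= N * (delta * p).
      rewrite -ler_pdivrMr ?mulr_gt0 //; apply: le_trans (ltW Hnd).
      by apply: ler_wpM2l HA; rewrite mulr_ge0 // ltW.
    have := ler_wpM2l (ltW n0) HA'.
    have := ler_wpM2l (ltW d0) Hp; lra.
  by rewrite /d4 in HY; lra.
move=> Z Z' mZ mZ'.
have [c Hc] : exists c, forall x y, x \in Z -> y \in Z' -> pavg k g (x, y) = c.
  have [->|[x0 x0Z]] := set_0Vmem Z; first by exists 0 => x y; rewrite inE.
  have [->|[y0 y0Z]] := set_0Vmem Z'; first by exists 0 => x y _; rewrite inE.
  exists (pavg k g (x0, y0)) => x y xZ yZ; apply: avg_eq.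
  by rewrite /pcol /= (monoP mZ xZ x0Z) (monoP mZ' yZ y0Z).
exists c => A' B' /subsetP AZ /subsetP BZ.
pose U w := (h w)%:R - f' w.
have cut (S1 T1 : {set 'I_n}) : `|\sum_(x in S1) \sum_(y in T1) U (x, y)| <= N ^+ 2 / d.
  have U1 w : `|U w| <= 1.
    rewrite /U ler_norml; have /andP[? ?] := f'01 w.
    by case: (h w); rewrite /= ?mulr1n ?mulr0n; apply/andP; split; lra.
  have := cut_norm_le S1 T1 U1; rewrite card_ord -/N.
  set X := \sum_(x in S1) _ => HX.
  have {HX} : `|X| ^+ 4 <= (N ^+ 2 / d) ^+ 4.
    rewrite -normrX ger0_norm ?exprn_even_ge0 //; apply: le_trans HX _.
    have -> : (N ^+ 2 / d) ^+ 4 = N ^+ 4 * (N / d) ^+ 4 by field.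
    by apply: ler_wpM2l Hcodeg; rewrite exprn_ge0 // ltW.
  by rewrite ler_pXn2r ?nnegrE // divr_ge0 ?exprn_ge0 // ltW.
(* [U] lives above the diagonal and its transpose supplies the entries below. On the diagonal the
   graph has [0] where [f] may not, whence the correction. *)
have EU x y : (adj (graph_of h) (x, y))%:R = U (x, y) + U (y, x) - (x == y)%:R * f (x, x)
   + (damp (pavg k g (x, y)) (pavg k' g (x, y)) * (g (x, y) - pavg k' g (x, y)))
   + pavg k g (x, y).
  have -> : (adj (graph_of h) (x, y))%:R = U (x, y) + U (y, x) - (x == y)%:R * f (x, x) + f (x, y).
    rewrite adj_graph_of /U /f' !inE /= -(inj_eq val_inj).
    case: ltngtP => [xy|yx|/val_inj ->].
    - rewrite (hD (y, x)) ?inE /= -?leqNgt ?(ltnW xy) //; ring.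
    - rewrite (hD (x, y)) ?inE /= -?leqNgt ?(ltnW yx) // fs; ring.
    - rewrite (hD (y, y)) ?inE /= ?ltnn //; ring.
  by rewrite /f /transfer -[RHS]addrA; congr (_ + _); exact: addrC.
rewrite (e_G_sum F).
have sumE : \sum_(x in A') \sum_(y in B') (adj (graph_of h) (x, y))%:R =
  \sum_(x in A') \sum_(y in B') U (x, y) + \sum_(x in B') \sum_(y in A') U (x, y)
  - \sum_(x in A') \sum_(y in B') (x == y)%:R * f (x, x)
  + \sum_(x in A') \sum_(y in B')
    (damp (pavg k g (x, y)) (pavg k' g (x, y)) * (g (x, y) - pavg k' g (x, y)))
  + c * (#|A'|%:R * #|B'|%:R).
  rewrite [X in _ = _ + X - _ + _ + _]exchange_big -sumrN -!big_split /=.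
  have -> : c * (#|A'|%:R * #|B'|%:R) = \sum_(x in A') \sum_(y in B') c.
    by under eq_bigr do rewrite sumr_const; rewrite sumr_const -mulrnA mulr_natr mulrnA; ring.
  rewrite -big_split; apply: eq_bigr => x xA.
  rewrite /= -sumrN -!big_split; apply: eq_bigr => y yB /=.
  by rewrite EU (Hc x y) ?AZ ?BZ.
have diag : `|\sum_(x in A') \sum_(y in B') (x == y)%:R * f (x, x)| <= N ^+ 2 / d.
  rewrite ger0_norm; last first.
    apply: sumr_ge0 => x _; apply: sumr_ge0 => y _.
    by rewrite mulr_ge0 ?ler0n //; have /andP[] := f01 (x, x).
  apply: (@le_trans _ _ (\sum_(x : 'I_n) 1)).
    rewrite big_mkcond; apply: ler_sum => x _; case: ifP => // _.
    rewrite big_mkcond; apply: (@le_trans _ _ (\sum_y (x == y)%:R)).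
      apply: ler_sum => y _; have /andP[? ?] := f01 (x, x).
      by case: (y \in B'); case: (x == y); rewrite ?mul1r ?mul0r.
    rewrite (bigD1 x) //= eqxx big1 ?addr0 // => y yx.
    by rewrite eq_sym (negbTE yx).
  rewrite sumr_const card_ord ler_pdivlMr // expr2 ler_pM2l //.
  by apply: le_trans d_le_d4 _; lra.
have := wr A' B'; rewrite card_ord -/N sumE addrK => Hwr.
have := cut A' B'; have := cut B' A'; move: diag Hwr.
set s1 := \sum_(x in A') \sum_(y in B') (x == y)%:R * _.
set s2 := \sum_(x in A') \sum_(y in B') damp _ _ * _.
set s3 := \sum_(x in A') \sum_(y in B') U _.
set s4 := \sum_(x in B') \sum_(y in A') U _.
rewrite !ler_norml => /andP[? ?] /andP[? ?] /andP[? ?] /andP[? ?].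
have E4 : 4 / d * N ^+ 2 = 4 * (N ^+ 2 / d) by ring.
have E1 : d^-1 * N ^+ 2 = N ^+ 2 / d by ring.
by rewrite E4; apply/andP; split; lra.
Qed.

(** For [eta = 1 / D] the least [J] with [1 < J * eta ^ 2] is [D ^ 2 + 1]. The size condition uses
    the a priori class bound [k1]; monotonicity of [D] passes it on to the number of classes
    actually reached. *)
Lemma regularized_graph n (E : graph n) (D : nat -> nat) (delta p : R)
    (T A : nat) :
  let J k := ((D k) ^ 2).+1 in let k1 := iter T (wr_step J) 1%N in
  is_graph E -> (forall k, 0 < D k)%N -> {homo D : k l / (k <= l)%N} ->
  0 < delta -> 0 < p -> p * n%:R ^+ 2 <= 2 * (nedges E)%:R ->
  - (T%:R * (delta / 4) ^+ 2 / 4) <= ln p ->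
  (delta * p)^-1 <= A%:R -> (16 * D k1 ^ 4 * A < n)%N ->
  exists (E' : graph n) (K : finType) (kappa : 'I_n -> K),
  [/\ is_graph E', #|(E :\: E') :|: (E' :\: E)|%:R <= delta * (nedges E)%:R,
    (#|K| <= k1)%N &
    forall Z Z' : {set 'I_n}, mono kappa Z -> mono kappa Z' ->
    exists c : R, forall A' B' : {set 'I_n}, A' \subset Z -> B' \subset Z' ->
    `|(e_G E' A' B')%:R - c * (#|A'|%:R * #|B'|%:R)| <= 4 / (D #|K|)%:R * n%:R ^+ 2].
Proof.
move=> J k1 gE D0 Dmono d0 p0 Hp HT HA Hn.
pose g := adjR R E.
have g01 w : 0 <= g w <= 1 by apply: adjR_ge0_le1.
have sg : \sum_w g w = 2 * (nedges E)%:R by apply: sum_adjR.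
pose eta k : R := (D k)%:R^-1.
have eta0 k : 0 < eta k by rewrite invr_gt0 ltr0n.
have A0 : (0 < A)%N.
  by rewrite -(ltr0n R); apply: lt_le_trans HA; rewrite invr_gt0 mulr_gt0.
have n0 : 0 < n%:R :> R by rewrite ltr0n; apply: leq_ltn_trans Hn.
have sg0 : 0 < \sum_w g w by rewrite sg; apply: lt_le_trans Hp; rewrite mulr_gt0 ?exprn_gt0.
have J_eta k : 1 < (J k)%:R * eta k ^+ 2.
  have Dk : 0 < (D k)%:R :> R by rewrite ltr0n.
  by rewrite /eta /J exprVn -natrX -[X in X%:R * _]addn1 natrD mulrDl divff ?mul1r ?ltrDl ?invr_gt0 ?ltr0n ?expn_gt0 ?D0 // pnatr_eq0 expn_eq0 negb_and -lt0n D0.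
have J_mono k l : (k <= l)%N -> (J k <= J l)%N.
  by move=> kl; rewrite ltnS leq_exp2r // Dmono.
pose d4 := delta / 4.
have [||K [K' [k [k' [rk' cK wr sm]]]]] :=
  @stable_refinement _ g g01 eta J eta0 J_eta J_mono d4 T sg0.
- by rewrite /d4; lra.
- apply: le_trans HT _; apply: ler_ln => //.
  by rewrite card_ord sg ler_pdivlMr ?exprn_gt0.
have Hn' : (16 * D #|K| ^ 4 * A < n)%N.
  by apply: leq_ltn_trans Hn; rewrite leq_pmul2r // leq_pmul2l // leq_exp2r // Dmono.
have [E' [gE' cE' H]] :=
  regularized_graph_of_stable gE rk' wr sm d0 p0 Hp HA (D0 _) Hn'.
by exists E', K, k.
Qed.
End Regularization.

(** * Regular equipartitions *)

Section RegularPartitions.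
Local Open Scope ring_scope.
Variable n : nat.
Implicit Types (E : graph n) (A B : {set 'I_n}) (P : {set {set 'I_n}}).

Lemma asboolP (Q : Prop) : reflect Q (asbool Q).
Proof. by rewrite /asbool; case: ClassicalDescription.excluded_middle_informative => H; constructor. Qed.

Lemma eps_regular_pairP E (eps : R) A B :
  (forall A' B' : {set 'I_n}, A' \subset A -> B' \subset B ->
    eps * #|A|%:R <= #|A'|%:R -> eps * #|B|%:R <= #|B'|%:R ->
    `|(e_G E A B)%:R / (#|A|%:R * #|B|%:R) -
      (e_G E A' B')%:R / (#|A'|%:R * #|B'|%:R)| <= eps) ->
  eps_regular_pair E eps A B.
Proof.
move=> H A' B' sA sB; rewrite !INRE => /RleP HA /RleP HB; apply/RleP.
by rewrite RabsE /d_G !INRE; apply: H.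
Qed.

(** All pairs of large subsets, including [A] and [B] themselves as [eps <= 1], have density within
    [eps / 2] of the common value [c]. *)
Lemma eps_regular_pair_of_approx E (eps c err : R) A B :
  0 < eps <= 1 -> (0 < #|A|)%N -> (0 < #|B|)%N ->
  (forall A' B' : {set 'I_n}, A' \subset A -> B' \subset B ->
    `|(e_G E A' B')%:R - c * (#|A'|%:R * #|B'|%:R)| <= err) ->
  err <= eps / 2 * (eps * #|A|%:R * (eps * #|B|%:R)) ->
  eps_regular_pair E eps A B.
Proof.
move=> /andP[e0 e1] A0 B0 H Herr; apply: eps_regular_pairP => A' B' sA sB HA HB.
have a0 : 0 < #|A|%:R :> R by rewrite ltr0n.
have b0 : 0 < #|B|%:R :> R by rewrite ltr0n.
have key (A1 B1 : {set 'I_n}) : A1 \subset A -> B1 \subset B ->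
    eps * #|A|%:R <= #|A1|%:R -> eps * #|B|%:R <= #|B1|%:R ->
    `|(e_G E A1 B1)%:R / (#|A1|%:R * #|B1|%:R) - c| <= eps / 2.
  move=> sA1 sB1 HA1 HB1.
  have a1 : 0 < #|A1|%:R :> R by apply: lt_le_trans HA1; rewrite mulr_gt0.
  have b1 : 0 < #|B1|%:R :> R by apply: lt_le_trans HB1; rewrite mulr_gt0.
  have ab1 : 0 < #|A1|%:R * #|B1|%:R :> R by rewrite mulr_gt0.
  have -> : (e_G E A1 B1)%:R / (#|A1|%:R * #|B1|%:R) - c =
     ((e_G E A1 B1)%:R - c * (#|A1|%:R * #|B1|%:R)) / (#|A1|%:R * #|B1|%:R).
    by field; rewrite !gt_eqF.
  rewrite normrM normfV (gtr0_norm ab1) ler_pdivrMr //.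
  apply: le_trans (H _ _ sA1 sB1) _; apply: le_trans Herr _.
  apply: ler_wpM2l; first by rewrite divr_ge0 ?ltW.
  by apply: ler_pM => //; rewrite mulr_ge0 ?ltW.
have K1 := key A B (subxx _) (subxx _) _ _.
have {}K1 : `|(e_G E A B)%:R / (#|A|%:R * #|B|%:R) - c| <= eps / 2.
  by apply: K1; rewrite ler_piMl // ltW.
have := key A' B' sA sB HA HB; move: K1.
rewrite !ler_norml => /andP[? ?] /andP[? ?]; apply/andP; split; lra.
Qed.

Lemma eps_regular_equipartition_all E (eps : R) P : 0 < eps -> equipartition P ->
  (forall A B, A \in P -> B \in P -> eps_regular_pair E eps A B) ->
  eps_regular_equipartition E eps P.
Proof.
move=> e0 eP H; split=> //; apply/RleP; rewrite !INRE.
set X := [set x | _]; have -> : X = set0.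
  apply/setP => -[A B]; rewrite !inE /=; apply/negP => /and3P[AP BP /asboolP].
  by apply; apply: H.
by rewrite cards0 !mulr_ge0 // ltW.
Qed.

Lemma eps_regular_pair_set1 E (eps : R) x y : 0 < eps ->
  eps_regular_pair E eps [set x] [set y].
Proof.
move=> e0; apply: eps_regular_pairP => A' B' sA sB; rewrite !cards1 !mulr1.
have sub1 z (C : {set 'I_n}) : C \subset [set z] -> eps <= #|C|%:R -> C = [set z].
  rewrite subset1 => /orP[/eqP//|/eqP->]; rewrite cards0.
  by move=> /(lt_le_trans e0); rewrite ltxx.
by move=> /(sub1 _ _ sA) -> /(sub1 _ _ sB) ->; rewrite !cards1 !mulr1 subrr normr0 ltW.
Qed.

Lemma discrete_regular E (eps : R) P0 : 0 < eps -> equipartition P0 ->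
  exists P, refines P P0 /\ #|P| = n /\ eps_regular_equipartition E eps P.
Proof.
move=> e0 [pP0 _]; exists [set [set x] | x : 'I_n]; split; last split.
- move=> _ /imsetP[x _ ->].
  have : x \in cover P0 by rewrite (cover_partition pP0) inE.
  by case/bigcupP => B BP xB; exists B => //; rewrite sub1set.
- by rewrite card_imset ?card_ord //; apply: set1_inj.
apply: eps_regular_equipartition_all => //.
  split; last by move=> _ _ /imsetP[x _ ->] /imsetP[y _ ->]; rewrite !cards1.
  apply/and3P; split.
  - apply/eqP/setP => x; rewrite inE; apply/bigcupP; exists [set x]; rewrite ?inE //.
    by apply/imsetP; exists x.
  - apply/trivIsetP => _ _ /imsetP[x _ ->] /imsetP[y _ ->] xy.
    by rewrite disjoints1 inE; apply: contraNneq xy => ->.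
  by apply/negP => /imsetP[x _ /esym/eqP]; rewrite -cards_eq0 cards1.
by move=> _ _ /imsetP[x _ ->] /imsetP[y _ ->]; apply: eps_regular_pair_set1.
Qed.

Lemma equipartition_sizes P0 : (0 < n)%N -> equipartition P0 ->
  exists s, (forall W, W \in P0 -> (s <= #|W| <= s.+1)%N) /\
   (n <= #|P0| * s.+1)%N.
Proof.
move=> n0 [pP0 eP0].
have [W0 W0P] : exists W, W \in P0.
  have : Ordinal n0 \in cover P0 by rewrite (cover_partition pP0) inE.
  by case/bigcupP => W WP _; exists W.
have [W WP Wmin] := arg_minnP (fun W : {set 'I_n} => #|W|) W0P.
have H W' : W' \in P0 -> (#|W| <= #|W'| <= #|W|.+1)%N.
  by move=> WP'; rewrite Wmin //= -addn1 eP0.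
exists #|W|; split=> //.
have nE : n = (\sum_(W in P0) #|W|)%N by rewrite -(card_partition pP0) cardsT card_ord.
apply: (leq_trans (eq_leq nE)); rewrite -sum_nat_const.
by apply: leq_sum => W' /H/andP[].
Qed.

Lemma equipartition_of_sizes P q : partition P [set: 'I_n] ->
  (forall Z, Z \in P -> (q <= #|Z| <= q.+1)%N) -> equipartition P.
Proof.
move=> pP sP; split=> // A B /sP/andP[_ A2] /sP/andP[B1 _].
by rewrite addn1; apply: leq_trans A2 _.
Qed.


End RegularPartitions.

(** * Choice of parameters and assembly *)

Section Bound.
Local Open Scope ring_scope.

(* With [N >= 1/eps], the final equipartition has [m <= 2 k N^2] parts, and a cut
   norm error [4 n^2 / disc N k] is small enough for [eps]-regularity once
   [32 m^2 N^3 <= disc N k]. *)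
Definition disc (N k : nat) : nat := (128 * N ^ 7 * k.+1 ^ 2)%N.

Definition parts (N T : nat) : nat := iter T (wr_step (fun k => (disc N k ^ 2).+1)) 1.

Lemma leq_disc N k : (N * (2 * k * N) <= disc N k)%N.
Proof.
rewrite /disc [leqRHS]mulnAC mulnC -mulnA; apply: leq_mul.
  by rewrite -mulnn; nia.
rewrite mulnn; case: N => // N; by rewrite leq_pexp2l.
Qed.

Lemma leq_disc_sqr N k m : (m <= N * (2 * k * N) -> 32 * m ^ 2 * N ^ 3 <= disc N k)%N.
Proof.
move=> mk; apply: (@leq_trans (32 * (N * (2 * k * N)) ^ 2 * N ^ 3)).
  by rewrite leq_mul2r leq_mul2l leq_exp2r ?mk ?orbT.
have -> : (32 * (N * (2 * k * N)) ^ 2 * N ^ 3 = 128 * N ^ 7 * k ^ 2)%N.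
  rewrite (_ : N ^ 7 = N ^ 2 * N ^ 2 * N ^ 3)%N; last by rewrite -!expnD.
  rewrite !expnMn.
  move: (N ^ 2)%N (N ^ 3)%N (k ^ 2)%N => y z a.
  by rewrite (_ : 2 ^ 2 = 4)%N //; lia.
by rewrite /disc leq_mul2l leq_exp2r ?leqnSn ?orbT.
Qed.

Lemma leq_mulS_double m q : (0 < q -> m * q.+1 <= 2 * m * q)%N.
Proof. by nia. Qed.

(** Of the three factors [eps], one is the tolerance and two come from the sizes of the subsets;
    [1 <= eps * N] turns [N ^ 3] into all three. *)
Lemma approx_arith (F : realFieldType) (eps : F) (n N m q d a b : nat) :
  0 < eps -> 1 <= eps * N%:R -> (n <= 2 * m * q)%N ->
  (32 * m ^ 2 * N ^ 3 <= d)%N -> (q <= a)%N -> (q <= b)%N -> (0 < d)%N ->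
  4 / d%:R * n%:R ^+ 2 <= eps / 2 * (eps * a%:R * (eps * b%:R)) :> F.
Proof.
move=> e0 eN nmq mD qa qb d0.
have dp : 0 < d%:R :> F by rewrite ltr0n.
have H1 : n%:R ^+ 2 <= 4 * m%:R ^+ 2 * q%:R ^+ 2 :> F.
  apply: (@le_trans _ _ ((2 * m * q)%:R ^+ 2)).
    by rewrite lerXn2r ?nnegrE ?ler0n // ler_nat.
  by rewrite !natrM le_eqVlt; apply/orP; left; apply/eqP; ring.
have H2 : 32 * m%:R ^+ 2 <= eps ^+ 3 * d%:R.
  have E3 : 1 <= (eps * N%:R) ^+ 3 by apply: exprn_ege1.
  have : 32 * m%:R ^+ 2 * N%:R ^+ 3 <= d%:R :> F by rewrite -!natrX -!natrM ler_nat.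
  move=> /(ler_wpM2l (exprn_ge0 3 (ltW e0))); apply: le_trans.
  rewrite (_ : eps ^+ 3 * _ = 32 * m%:R ^+ 2 * (eps * N%:R) ^+ 3); last by ring.
  by rewrite ler_peMr // mulr_ge0 // sqr_ge0.
have H3 : q%:R ^+ 2 <= a%:R * b%:R :> F by rewrite -natrX -natrM ler_nat -mulnn leq_mul.
rewrite mulrAC ler_pdivrMr //.
apply: (@le_trans _ _ (16 * m%:R ^+ 2 * q%:R ^+ 2)); first by lra.
apply: (@le_trans _ _ (eps ^+ 3 * d%:R / 2 * q%:R ^+ 2)).
  by apply: ler_wpM2r; [apply: sqr_ge0 | lra].
rewrite (_ : eps / 2 * _ * _ = eps ^+ 3 * d%:R / 2 * (a%:R * b%:R)); last by ring.
by apply: ler_wpM2l => //; rewrite divr_ge0 // mulr_ge0 ?exprn_ge0 // ltW.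
Qed.

(** The claimed order doubles as a threshold for [n]: beyond it the size condition of
    [regularized_graph] holds, and up to it singletons are few enough. *)
Lemma S_ok_main (eps delta p : R) (N A T : nat) :
  0 < eps <= 1 -> 0 < delta -> 0 < p -> eps^-1 <= N%:R ->
  (delta * p)^-1 <= A%:R -> - (T%:R * (delta / 4) ^+ 2 / 4) <= ln p ->
  S_ok eps delta p (16 * disc N (parts N T) ^ 4 * A).
Proof.
move=> /andP[e0 e1] d0 p0 HN HA HT n E gE Hp P0 eP0 cP0.
set Bd := (16 * _ * _)%N.
have N0 : (0 < N)%N by rewrite -(ltr0n R); apply: lt_le_trans HN; rewrite invr_gt0.
have A0 : (0 < A)%N.
  by rewrite -(ltr0n R); apply: lt_le_trans HA; rewrite invr_gt0 mulr_gt0.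
have k0N : (#|P0| <= N)%N.
  rewrite -(ler_nat R); apply: le_trans HN; move: cP0 => /RleP; rewrite INRE.
  by rewrite RdivE div1r.
have D0 k : (0 < disc N k)%N by rewrite /disc 2!muln_gt0 !expn_gt0 N0.
have discrete : (n <= Bd)%N -> exists E' : graph n, is_graph E' /\
   Rle (INR #|(E :\: E') :|: (E' :\: E)|) (Rmult delta (INR (nedges E))) /\
    exists P : {set {set 'I_n}},
      refines P P0 /\ (#|P| <= Bd)%N /\ eps_regular_equipartition E' eps P.
  move=> nB; exists E; split=> //; split.
    apply/RleP; rewrite setDv setU0 cards0 !INRE.
    by rewrite mulr_ge0 // ltW.
  have [P [rP [cP reg]]] := discrete_regular E e0 eP0.
  by exists P; rewrite cP.
have [/discrete//|nB] := leqP n Bd.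
have n0 : (0 < n)%N by apply: leq_ltn_trans nB.
have Hp' : p * n%:R ^+ 2 <= 2 * (nedges E)%:R.
  move: Hp => /RleP; rewrite /density !INRE RdivE !RmultE -expr2.
  by rewrite ler_pdivlMr // exprn_gt0 // ltr0n.
have Dmono : {homo disc N : k l / (k <= l)%N}.
  by move=> k l kl; rewrite /disc leq_mul // leq_exp2r.
have [E' [K [kappa [gE' cE' cK H]]]] :=
  @regularized_graph n E (disc N) delta p T A gE D0 Dmono d0 p0 Hp' HT HA nB.
set k := #|K| in cK H; rewrite -/(parts N T) in cK.
have k_gt0 : (0 < k)%N by apply/card_gt0P; exists (kappa (Ordinal n0)).
have DkB : (disc N k <= Bd)%N.
  apply: leq_trans (Dmono _ _ cK) _; rewrite /Bd.
  set d1 := disc N _; have H4 : (d1 <= d1 ^ 4)%N.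
    by rewrite -{1}[d1]expn1 leq_pexp2l // D0.
  by apply: leq_trans H4 _; rewrite -mulnA mulnCA leq_pmulr // muln_gt0.
(* Of the [m = #|P0| * r] parts at most [#|P0| * k = m / (2 * N)] are not monochromatic, so at most
   [m ^ 2 / N <= eps * m ^ 2] ordered pairs contain one. *)
pose r := (2 * k * N)%N.
have r0 : (0 < r)%N by rewrite !muln_gt0 k_gt0.
have [s [sP0 ns]] := equipartition_sizes n0 eP0.
(* Otherwise [n <= #|P0| * s.+1 <= N * r], which is below the threshold. *)
have rs : (r <= s)%N.
  rewrite leqNgt; apply/negP => sr; have : (n <= disc N k)%N.
    apply: leq_trans ns _; apply: leq_trans (leq_mul k0N sr) _.
    exact: leq_disc.
  by rewrite leqNgt (leq_ltn_trans DkB nB).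
have [P [[pP rP] cP sP mP]] :=
  equitable_refinement kappa eP0.1 sP0 (introT andP (conj r0 rs)).
set q := (s %/ r)%N in sP.
have q0 : (0 < q)%N by rewrite divn_gt0.
have eP : equipartition P by apply: equipartition_of_sizes pP sP.
set m := #|P| in cP mP.
have nmq : (n <= 2 * m * q)%N.
  have nE : n = (\sum_(Z in P) #|Z|)%N by rewrite -(card_partition pP) cardsT card_ord.
  apply: (leq_trans (eq_leq nE)); apply: (@leq_trans (m * q.+1)); last exact: leq_mulS_double.
  by rewrite -sum_nat_const; apply: leq_sum => Z /sP/andP[].
have mD : (32 * m ^ 2 * N ^ 3 <= disc N k)%N.
  by apply: leq_disc_sqr; rewrite cP leq_mul2r k0N orbT.
exists E'; split=> //; split; first by apply/RleP; rewrite RmultE !INRE.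
exists P; split=> //; split.
  apply: leq_trans DkB; apply: leq_trans mD; rewrite -/m.
  have N3 : (0 < N ^ 3)%N by rewrite expn_gt0 N0.
  by apply: leq_trans (leq_pmulr _ N3); case: (m) => // m'; rewrite -mulnn mulnCA leq_pmulr.
split=> //; apply/RleP; rewrite !RmultE !INRE -/m.
set X := [set x | _].
have eN : 1 <= eps * N%:R by rewrite -ler_pdivrMl // mulr1.
have Xsub : X \subset setX [set Z in P | ~~ mono kappa Z] P :|:
                     setX P [set Z in P | ~~ mono kappa Z].
  apply/subsetP => -[Z Z']; rewrite !inE /= => /and3P[ZP ZP' /asboolP irr].
  rewrite ZP ZP' /= andbT; apply/orP; case: (boolP (mono kappa Z)) => [mZ|]; last by left.
  case: (boolP (mono kappa Z')) => [mZ'|]; last by right.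
  case: irr; have [c Hc] := H Z Z' mZ mZ'.
  have /andP[qZ _] := sP Z ZP; have /andP[qZ' _] := sP Z' ZP'.
  apply: (eps_regular_pair_of_approx _ _ _ Hc).
  - by rewrite e0.
  - exact: leq_trans qZ.
  - exact: leq_trans qZ'.
  exact: (approx_arith e0 eN nmq mD qZ qZ' (D0 k)).
have Xle : (#|X| <= 2 * (#|P0| * k * m))%N.
  apply: leq_trans (subset_leq_card Xsub) _; apply: leq_trans (leq_card_setU _ _) _.
  rewrite !cardsX -/m mulnC addnn -mul2n leq_mul2l /=.
  by rewrite mulnC leq_mul2r mP orbT.
apply: (@le_trans _ _ (2 * (#|P0| * k * m))%:R); first by rewrite ler_nat.
have := ler_wpM2l (ler0n R (2 * (#|P0| * k * m))) eN; rewrite mulr1.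
move/le_trans; apply; rewrite le_eqVlt; apply/orP; left; apply/eqP.
by rewrite {2}cP /r !natrM; ring.
Qed.
End Bound.

(** * Extreme parameters *)

Section ExtremeCases.
Local Open Scope ring_scope.

Lemma S_le (eps delta p : R) N : S_ok eps delta p N -> (S eps delta p <= N)%N.
Proof.
move=> H; have HN : asbool (S_ok eps delta p N) by apply/asboolP.
rewrite /S; case: ClassicalDescription.excluded_middle_informative => // ex.
by case: ex_minnP => m _; apply.
Qed.

Lemma density_leP n (E : graph n) (p : R) : 0 < p -> Rle p (density E) ->
  (0 < n)%N /\ p * n%:R ^+ 2 <= 2 * (nedges E)%:R.
Proof.
move=> p0 /RleP; rewrite /density !INRE RdivE !RmultE -expr2 => H.
have n0 : (0 < n)%N.
  (* Without vertices the density is [0], because division by [0] gives [0]. *)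
  rewrite lt0n; apply/negP => /eqP n0; have nR : n%:R = 0 :> R by rewrite n0.
  by move: H; rewrite nR expr0n /= invr0 mulr0 leNgt p0.
by split=> //; move: H; rewrite ler_pdivlMr // exprn_gt0 // ltr0n.
Qed.

Lemma card_part_gt0 n (P0 : {set {set 'I_n}}) : (0 < n)%N ->
  partition P0 [set: 'I_n] -> (0 < #|P0|)%N.
Proof.
move=> n0 pP0; have : Ordinal n0 \in cover P0 by rewrite (cover_partition pP0) inE.
by case/bigcupP => W WP _; apply/card_gt0P; exists W.
Qed.

Lemma card_adj_lt n (E : graph n) : (0 < n)%N -> is_graph E ->
  (2 * nedges E < n ^ 2)%N.
Proof.
move=> n0 gE; rewrite -card_adj //.
have -> : (n ^ 2 = #|[set: 'I_n * 'I_n]|)%N by rewrite cardsT card_prod card_ord mulnn.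
apply: proper_card; rewrite properT; apply/eqP => /setP/(_ (Ordinal n0, Ordinal n0)).
by rewrite !inE adj_irrefl.
Qed.

(** Vacuous, since the empty diagonal keeps every density below 1. *)
Lemma S_ok_dense (eps delta p : R) : 1 <= p -> S_ok eps delta p 0.
Proof.
move=> p1 n E gE Hp; have p0 : 0 < p by apply: lt_le_trans p1.
have [n0 H] := density_leP p0 Hp; have := card_adj_lt n0 gE.
rewrite -(ltr_nat R) natrM natrX => H'; have := le_lt_trans H H'.
by rewrite ltNge ler_peMl // sqr_ge0.
Qed.

(** Vacuous: positive density forces a vertex, and then [P0] has a part, although [1 / eps < 1]. *)
Lemma S_ok_large_eps (eps delta p : R) : 1 < eps -> 0 < p -> S_ok eps delta p 0.
Proof.
move=> e1 p0 n E gE Hp P0 [pP0 _] /RleP; rewrite INRE RdivE div1r => H.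
have [n0 _] := density_leP p0 Hp; have := card_part_gt0 n0 pP0.
rewrite -(ler1n R) => /le_trans /(_ H).
by rewrite leNgt invf_lt1 ?e1 // (lt_trans ltr01).
Qed.

(** All edges may be deleted, and in the empty graph [P0] itself is regular. *)
Lemma S_ok_empty (eps delta p : R) N : 0 < eps -> 1 <= delta ->
  (forall k : nat, k%:R <= eps^-1 -> (k <= N)%N) -> S_ok eps delta p N.
Proof.
move=> e0 d1 HN n E gE Hp P0 eP0 /RleP; rewrite INRE RdivE div1r => cP0.
exists set0; split; first by move=> e; rewrite inE.
split.
  by apply/RleP; rewrite set0D setD0 setU0 RmultE !INRE ler_peMl.
exists P0; split; first by move=> A AP; exists A.
split; first exact: HN.
apply: eps_regular_equipartition_all => // A B _ _.
apply: eps_regular_pairP => A' B' _ _ _ _.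
have e_0 (A1 B1 : {set 'I_n}) : e_G (set0 : graph n) A1 B1 = 0%N.
  by apply/eqP; rewrite cards_eq0; apply/eqP/setP => w; rewrite !inE !andbF.
by rewrite !e_0 !mul0r subrr normr0 ltW.
Qed.

Definition complete n : graph n := [set e : {set 'I_n} | #|e| == 2%N].

Lemma e_G_complete n (A B : {set 'I_n}) : [disjoint A & B] ->
  e_G (complete n) A B = (#|A| * #|B|)%N.
Proof.
move=> dAB; rewrite -cardsX; apply: eq_card => -[x y]; rewrite !inE /=.
case xA: (x \in A); case yB: (y \in B); rewrite // cards2.
by have [Exy|//] := eqVneq x y; have := disjointFr dAB xA; rewrite Exy yB.
Qed.

(* In the complete graph only the diagonal pairs can be irregular, and they are
   negligible once there are at least [1/eps] parts. *)
Lemma S_ok_complete (eps delta p : R) N : 0 < eps <= 1 -> 0 < delta -> 0 < p ->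
  1 <= (1 + delta) * p ->
  (forall k : nat, (0 < k)%N -> k%:R <= eps^-1 ->
     exists2 r, (0 < r)%N & eps^-1 <= (k * r)%:R /\ (k * r <= N)%N) ->
  S_ok eps delta p N.
Proof.
move=> /andP[e0 e1] d0 p0 Hd HN n E gE Hp P0 eP0 /RleP; rewrite INRE RdivE div1r => cP0.
have [n0 HE] := density_leP p0 Hp.
have [r r0 [Hr HrN]] := HN _ (card_part_gt0 n0 eP0.1) cP0.
have gC : is_graph (complete n) by move=> e; rewrite inE => /eqP.
have EC : E \subset complete n by apply/subsetP => e /gE; rewrite inE => /eqP.
(* The complete graph has fewer than [n ^ 2 / 2] edges, hence fewer than [(1 + delta) * |E|]. *)
have edits : #|(E :\: complete n) :|: (complete n :\: E)|%:R <= delta * (nedges E)%:R.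
  have -> : E :\: complete n = set0 by apply/eqP; rewrite setD_eq0.
  rewrite set0U cardsD (setIidPr EC) natrB ?subset_leq_card //.
  have := card_adj_lt n0 gC; rewrite -(ltr_nat R) natrM natrX /nedges => HC.
  have n2 : 0 <= n%:R ^+ 2 :> R by rewrite sqr_ge0.
  have d1 : 0 <= 1 + delta by lra.
  have h1 := ler_wpM2r n2 Hd.
  have h2 := ler_wpM2l d1 HE.
  rewrite mul1r -mulrA in h1; have h3 := le_trans h1 h2.
  by rewrite /nedges in h3 *; lra.
have [s [sP0 ns]] := equipartition_sizes n0 eP0.
have edits' : Rle (INR #|(E :\: complete n) :|: (complete n :\: E)|)
    (Rmult delta (INR (nedges E))) by apply/RleP; rewrite RmultE !INRE.
exists (complete n); split=> //; split=> //.
(* If the parts are too small to be cut into [r] chunks, then [n <= #|P0| * r <= N] and singletons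
   do. *)
have [rs|sr] := leqP r s; last first.
  have [P [rP [cP reg]]] := discrete_regular (complete n) e0 eP0.
  exists P; split=> //; split=> //; rewrite cP; apply: leq_trans ns _.
  by apply: leq_trans HrN; rewrite leq_mul2l sr orbT.
have [P [[pP rP] cP sP _]] :=
  equitable_refinement (fun=> tt) eP0.1 sP0 (introT andP (conj r0 rs)).
have q0 : (0 < s %/ r)%N by rewrite divn_gt0.
have eP : equipartition P by apply: equipartition_of_sizes pP sP.
exists P; split=> //; split; first by rewrite cP.
split=> //; apply/RleP; rewrite !RmultE !INRE.
set X := [set x | _].
have Xle : (#|X| <= #|P|)%N.
  rewrite -(card_imset (mem P) (f := fun Z => (Z, Z))); last by move=> ? ? [].
  apply/subset_leq_card/subsetP => -[Z Z']; rewrite !inE /= => /and3P[ZP ZP' /asboolP irr].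
  have [<-|ZZ'] := eqVneq Z Z'; first by apply/imsetP; exists Z.
  case: irr.
  have dZ := trivIsetP (partition_trivIset pP) _ _ ZP ZP' ZZ'.
  have /andP[qZ _] := sP Z ZP; have /andP[qZ' _] := sP Z' ZP'.
  have approx (A' B' : {set 'I_n}) : A' \subset Z -> B' \subset Z' ->
      `|(e_G (complete n) A' B')%:R - 1 * (#|A'|%:R * #|B'|%:R)| <= 0 :> R.
    move=> sA sB; rewrite e_G_complete; last exact: disjointWl sA (disjointWr sB dZ).
    by rewrite natrM mul1r subrr normr0.
  apply: (eps_regular_pair_of_approx _ _ _ approx).
  - by rewrite e0.
  - exact: leq_trans qZ.
  - exact: leq_trans qZ'.
  by have e0' := ltW e0; rewrite !mulr_ge0 ?invr_ge0 ?ler0n.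
apply: (@le_trans _ _ #|P|%:R); first by rewrite ler_nat.
by rewrite ler_peMl // -ler_pdivrMl // mulr1 cP.
Qed.

End ExtremeCases.

(** * Tower bounds *)

Section NatTower.

Definition ntw (N j : nat) : nat := iter j (expn 2) N.

Lemma ntw_leS N j : ntw N j <= ntw N j.+1.
Proof. by rewrite /= ltnW // ltn_expl. Qed.

Lemma ntw_le N i j : i <= j -> ntw N i <= ntw N j.
Proof.
move=> /subnK <-; elim: (j - i) => [|m IH] //; rewrite addSn.
exact: leq_trans IH (ntw_leS _ _).
Qed.

Lemma leq_ntw_height N j : j <= ntw N j.
Proof. by elim: j => // j IH; apply: leq_ltn_trans IH (ltn_expl _ _). Qed.

Lemma leq_ntw_base M N j : M <= N -> ntw M j <= ntw N j.
Proof. by move=> MN; elim: j => //= j IH; rewrite leq_exp2l. Qed.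

Variable N : nat.
Hypothesis N0 : 0 < N.
Implicit Types a b c j : nat.

Lemma ntw_exp a j : a <= ntw N j -> 2 ^ a <= ntw N j.+1.
Proof. by move=> H; rewrite /= leq_exp2l. Qed.

Lemma ntw_succ a j : a <= ntw N j -> a.+1 <= ntw N j.+1.
Proof. by move=> H; apply: leq_ltn_trans H (ltn_expl _ _). Qed.

(** For [a], [b] at most [z] the product is at most [2 ^ (2 * z)], and [2 * z <= 2 ^ z]. Such waste
    is affordable, as only a height linear in [T] matters. *)
Lemma ntw_mul a b j : a <= ntw N j -> b <= ntw N j -> a * b <= ntw N j.+2.
Proof.
move=> Ha Hb; set z := ntw N j in Ha Hb.
have lt y : y < 2 ^ y by apply: ltn_expl.
have H2 : 2 * z <= 2 ^ z.
  by case: (z) => // y; rewrite expnS leq_mul2l /=.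
apply: leq_trans (leq_mul Ha Hb) _.
apply: leq_trans (leq_mul (ltnW (lt z)) (ltnW (lt z))) _.
by rewrite -expnD addnn -mul2n; apply: ntw_exp.
Qed.

Lemma ntw_const c j : c <= 65536 -> 4 <= j -> c <= ntw N j.
Proof.
move=> Hc Hj; apply: leq_trans (ntw_le N Hj).
apply: leq_trans (leq_ntw_base 4 N0); apply: leq_trans Hc _.
by rewrite (_ : 65536 = 2 ^ 16) // leq_exp2l.
Qed.

Lemma ntw_mono a i j : a <= ntw N i -> i <= j -> a <= ntw N j.
Proof. by move=> H ij; apply: leq_trans H (ntw_le N ij). Qed.

Lemma ntw_disc k j : 4 <= j -> k <= ntw N j -> disc N k <= ntw N (j + 10).
Proof.
move=> j4 Hk; rewrite /disc.
have HN : N <= ntw N j by apply: (@ntw_mono N 0).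
have N2 : N * N <= ntw N j.+2 by apply: ntw_mul.
have N4 : (N * N) * (N * N) <= ntw N j.+4 by apply: ntw_mul.
have N8 : N ^ 8 <= ntw N (j + 6).
  rewrite (_ : N ^ 8 = (N * N) * (N * N) * ((N * N) * (N * N))); last by rewrite !mulnn -!expnM.
  by rewrite (_ : j + 6 = j.+4.+2) ?addnS ?addn0 //; apply: ntw_mul.
have N7 : N ^ 7 <= ntw N (j + 6) by apply: leq_trans N8; rewrite leq_pexp2l.
have H1 : 128 * N ^ 7 <= ntw N (j + 8).
  rewrite (_ : j + 8 = (j + 6).+2); last by rewrite !addnS.
  by apply: ntw_mul => //; apply: ntw_const => //; lia.
have H2 : k.+1 ^ 2 <= ntw N (j + 8).
  apply: (@ntw_mono _ j.+3); last by lia.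
  by rewrite -mulnn; apply: ntw_mul; apply: ntw_succ.
by rewrite (_ : j + 10 = (j + 8).+2); [apply: ntw_mul | rewrite !addnS].
Qed.

(** One step costs 18 levels: 10 for [disc], 3 for its square plus one, 3 for the power of 4, 2 for
    the factor [k]. The initial 4 makes room for numerical constants. *)
Lemma ntw_parts T : parts N T <= ntw N (18 * T + 4).
Proof.
elim: T => [|T IH]; first by apply: ntw_const.
rewrite /parts iterS -/(parts N T) /wr_step; set k := parts N T in IH *.
set j := 18 * T + 4 in IH *.
have j4 : 4 <= j by rewrite leq_addl.
have Hd := ntw_disc j4 IH.
have H1 : (disc N k ^ 2).+1 <= ntw N (j + 13).
  rewrite (_ : j + 13 = (j + 10).+3); last by rewrite !addnS.
  by apply: ntw_succ; rewrite -mulnn; apply: ntw_mul.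
have H2 : 4 ^ (disc N k ^ 2).+1 <= ntw N (j + 16).
  rewrite (_ : 4 = 2 ^ 2) // -expnM (_ : j + 16 = (j + 13).+3); last by rewrite !addnS.
  by apply: ntw_exp; apply: ntw_mul => //; apply: ntw_const => //; lia.
rewrite (_ : 18 * T.+1 + 4 = (j + 16).+2); last by rewrite /j; lia.
by apply: ntw_mul => //; apply: ntw_mono IH _; lia.
Qed.

(** The top of the tower is reserved for [N], so the factor [A] is absorbed by the height, through
    [b <= ntw N b]. *)
Lemma ntw_bound T A b : A <= 2 ^ b ->
  16 * disc N (parts N T) ^ 4 * A <= ntw N (18 * T + b + 23).
Proof.
move=> HA; have Hd := ntw_disc (leq_addl _ _) (ntw_parts T).
set d := disc _ _ in Hd *; set j := 18 * T + 4 + 10 in Hd.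
have D4 : d ^ 4 <= ntw N j.+4.
  by rewrite (_ : d ^ 4 = (d * d) * (d * d)); [do 2!apply: ntw_mul | rewrite !mulnn -!expnM].
have H1 : 16 * d ^ 4 <= ntw N j.+4.+2.
  by apply: ntw_mul => //; apply: ntw_const => //; lia.
have HA' : A <= ntw N b.+1 by apply: leq_trans HA _; apply: ntw_exp; apply: leq_ntw_height.
rewrite (_ : 18 * T + b + 23 = (18 * T + b + 21).+2); last by rewrite !addnS.
by apply: ntw_mul; [apply: ntw_mono H1 _ | apply: ntw_mono HA' _]; rewrite /j; lia.
Qed.

End NatTower.

Section Iterated.
Local Open Scope R_scope.

(** The [64] is [4 * 4 ^ 2]: one step gains [(delta / 4) ^ 2 / 4]. *)
Lemma S_ok_iterated (eps delta p : R) (N A T : nat) :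
  0 < eps <= 1 -> 0 < delta -> 0 < p -> 1 / eps <= INR N ->
  1 / (delta * p) <= INR A -> ln (1 / p) <= INR T * delta ^ 2 / 64 ->
  S_ok eps delta p (16 * disc N (parts N T) ^ 4 * A).
Proof.
move=> [/RltP e0 /RleP e1] /RltP d0 /RltP p0 HN HA HT; apply: S_ok_main => //.
- by apply/andP; split.
- by apply/RleP; rewrite -INRE -[(_^-1)%R]/(/ eps); Lra.lra.
- by apply/RleP; rewrite -INRE -[(_^-1)%R]/(/ (delta * p)); Lra.lra.
apply/RleP; have /RltP p0' := p0.
have E : ln p = - ln (1 / p).
  by rewrite /Rdiv Rmult_1_l ln_Rinv //; Lra.lra.
rewrite E; apply: Ropp_le_contravar; apply: Rle_trans HT _.
by apply: Req_le; rewrite !RealsE /=; field.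
Qed.

End Iterated.

(* From here on [field] is the tactic of Stdlib, which understands [IZR]. *)
Import Stdlib.setoid_ring.Field.

(** * Towers over the reals *)

Section RealTower.
Local Open Scope R_scope.

Lemma ceil_nat_ge (x : R) : x <= INR (ceil_nat x).
Proof.
have [H1 H2] := base_Int_part (- x); rewrite /ceil_nat.
have [Hz|Hz] := Z_le_gt_dec 0 (- Int_part (- x)).
  by rewrite INR_IZR_INZ Z2Nat.id // opp_IZR; Lra.lra.
have : IZR (- Int_part (- x)) <= 0 by apply: IZR_le; Lia.lia.
by rewrite opp_IZR; have := pos_INR (Z.to_nat (- Int_part (- x))); Lra.lra.
Qed.

Lemma ceil_nat_lt (x : R) : 0 <= x -> INR (ceil_nat x) < x + 1.
Proof.
move=> x0; have [H1 H2] := base_Int_part (- x); rewrite /ceil_nat.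
have Hz : Z.le 0 (- Int_part (- x)).
  have : IZR (Int_part (- x)) <= IZR 0 by Lra.lra.
  by move=> /le_IZR; Lia.lia.
by rewrite INR_IZR_INZ Z2Nat.id // opp_IZR; Lra.lra.
Qed.

Lemma ceil_nat_gt0 (x : R) : 0 < x -> (0 < ceil_nat x)%N.
Proof.
move=> x0; have := ceil_nat_ge x; case: (ceil_nat x) => //=; Lra.lra.
Qed.

Lemma ceil_nat_le0 (x : R) : x <= 0 -> ceil_nat x = 0%N.
Proof.
move=> x0; have [H1 H2] := base_Int_part (- x); rewrite /ceil_nat.
have : Z.lt (-1) (Int_part (- x)) by apply: lt_IZR; Lra.lra.
by Lia.lia.
Qed.

Lemma exists_floor (y : R) : 0 <= y ->
  exists m : nat, INR m <= y /\ forall k : nat, INR k <= y -> (k <= m)%N.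
Proof.
move=> y0; have [H1 H2] := base_Int_part y.
have Hz : Z.le 0 (Int_part y).
  have : Z.lt (-1) (Int_part y) by apply: lt_IZR; Lra.lra.
  Lia.lia.
have E : INR (Z.to_nat (Int_part y)) = IZR (Int_part y) by rewrite INR_IZR_INZ Z2Nat.id.
exists (Z.to_nat (Int_part y)); split; first by rewrite E; Lra.lra.
move=> k Hk; rewrite -ltnS; apply/ssrnat.ltP; apply: INR_lt; rewrite S_INR E; Lra.lra.
Qed.

(** This is [2 ^ t >= 1 + t * ln 2] with [ln 2 > 1 / 2]; it suffices for comparing powers of 2 with
    linear functions. *)
Lemma Rpower2_ge (a : nat) (x : R) : INR a <= x ->
  2 ^ a * (1 + (x - INR a) / 2) <= Rpower 2 x.
Proof.
move=> ax; rewrite (_ : x = INR a + (x - INR a)); last by Lra.lra.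
rewrite Rpower_plus Rpower_pow; last by Lra.lra.
apply: Rmult_le_compat_l; first by apply: pow_le; Lra.lra.
rewrite (_ : INR a + (x - INR a) - INR a = x - INR a); last by Lra.lra.
rewrite /Rpower; have := exp_ineq1_le ((x - INR a) * ln 2); have := ln_lt_2.
Lra.nra.
Qed.

Lemma Rpower2_mono (x y : R) : x <= y -> Rpower 2 x <= Rpower 2 y.
Proof. by move=> xy; apply: Rle_Rpower => //; Lra.lra. Qed.

Lemma le_Rpower2 (x : R) : x <= Rpower 2 x.
Proof.
have [x0|x0] := Rle_lt_dec x 0; first by have := exp_pos (x * ln 2); rewrite /Rpower; Lra.lra.
have [x1|x1] := Rle_lt_dec x 1.
  by have := @Rpower2_ge 0 x; rewrite /=; Lra.lra.
have := @Rpower2_ge 1 x; rewrite /=; Lra.lra.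
Qed.

Lemma INR_exp2 (m : nat) : INR (2 ^ m)%N = Rpower 2 (INR m).
Proof.
rewrite Rpower_pow; last by Lra.lra.
by elim: m => // m IH; rewrite expnS mult_INR IH.
Qed.

Lemma twr_leS (y : R) (j : nat) : twr y j <= twr y j.+1.
Proof. exact: le_Rpower2. Qed.

Lemma twr_le (y : R) (i j : nat) : (i <= j)%N -> twr y i <= twr y j.
Proof.
move=> /subnK <-; elim: (j - i)%N => [|m IH]; first exact: Rle_refl.
by rewrite addSn; apply: Rle_trans IH (twr_leS _ _).
Qed.

Lemma twr_base_le (x y : R) (j : nat) : x <= y -> twr x j <= twr y j.
Proof. by move=> xy; elim: j => //= j IH; apply: Rpower2_mono. Qed.

Lemma twr_add (y : R) (i j : nat) : twr (twr y i) j = twr y (j + i).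
Proof. by elim: j => //= j ->. Qed.

Lemma INR_le_twr1 (j : nat) : INR j <= twr 1 j.
Proof.
elim: j => [|j IH]; first by rewrite /=; Lra.lra.
rewrite S_INR /=; apply: Rle_trans (Rpower2_mono IH).
rewrite -INR_exp2 -S_INR; apply: le_INR; apply/ssrnat.leP; exact: ltn_expl.
Qed.

(** The extra level pays for rounding the top up, since [x + 1 <= 2 ^ x] for [x >= 1]. *)
Lemma ntw_le_twr (x : R) (j : nat) : 1 <= x ->
  INR (ntw (ceil_nat x) j) <= twr x j.+1.
Proof.
move=> x1; elim: j => [|j IH]; last by rewrite /ntw iterS INR_exp2; apply: Rpower2_mono.
have := @Rpower2_ge 1 x; have := @ceil_nat_lt x; rewrite /=; Lra.lra.
Qed.

End RealTower.

(** * The explicit constant *)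

Section PolyRegularity.
Local Open Scope R_scope.

Lemma inv_mul (a : R) : 0 < a -> 1 / a * a = 1.
Proof. by move=> a0; field; Lra.lra. Qed.

(** Where the complete graph is out of reach, this keeps [ln (1 / p) / delta ^ 2] away from [0], so
    that additive constants in the height can be absorbed. *)
Lemma ln_inv_ge (delta p : R) : 0 < delta -> 0 < p -> (1 + delta) * p < 1 ->
  delta <= 1 -> delta / 2 <= ln (1 / p).
Proof.
move=> d0 p0 Hp d1.
have ip : 0 < / p by apply: Rinv_0_lt_compat.
have H1 : 1 + delta < 1 / p.
  apply: (Rmult_lt_reg_r p) => //; rewrite inv_mul; Lra.lra.
have H2 : - ln (1 / p) = ln (/ (1 / p)) by rewrite ln_Rinv //; Lra.lra.
have i0 : 0 < / (1 / p) by apply: Rinv_0_lt_compat; Lra.lra.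
have H3 := ln_le_sub1 i0.
have H4 : / (1 / p) <= / (1 + delta) by apply: Rinv_le_contravar; Lra.lra.
have H5 : / (1 + delta) <= 1 - delta / 2.
  apply: (Rmult_le_reg_r (1 + delta)); first by Lra.lra.
  rewrite Rinv_l; Lra.nra.
Lra.lra.
Qed.

Lemma exp_le_pow4 (x : R) (a : nat) : x <= INR a -> exp x <= INR (2 ^ (2 * a))%N.
Proof.
move=> xa; apply: (@Rle_trans _ (exp (INR a))).
  by case: xa => [xa|->]; [left; apply: exp_increasing | right].
rewrite expnM (_ : 2 ^ 2 = 4)%N //; elim: (a) => [|b IH]; first by rewrite exp_0 /=; Lra.lra.
rewrite S_INR exp_plus expnS mult_INR Rmult_comm.
have E4 : exp 1 <= INR 4 by have := exp_le_3; rewrite /=; Lra.lra.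
by apply: Rmult_le_compat => //; left; apply: exp_pos.
Qed.

(** The height may be just 1, so the number of parts has to stay within [2 ^ (1 / eps)]. *)
Lemma S_bound_complete (eps delta p : R) (h : nat) :
  0 < eps <= 1 -> 0 < delta -> 0 < p -> 1 <= (1 + delta) * p -> (0 < h)%N ->
  INR (S eps delta p) <= twr (1 / eps) h.
Proof.
move=> [e0 e1] d0 p0 Hp h0; set x := 1 / eps.
have x1 : 1 <= x.
  by apply: (Rmult_le_reg_r eps) => //; rewrite /x inv_mul; Lra.lra.
have [N [HN1 HN2]] : exists N : nat, INR N <= Rpower 2 x /\
    forall k : nat, INR k <= Rpower 2 x -> (k <= N)%N.
  by apply: exists_floor; left; apply: exp_pos.
apply: (@Rle_trans _ (INR N)); last first.
  by apply: Rle_trans HN1 _; apply: (@twr_le x 1 h).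
apply: le_INR; apply/ssrnat.leP; apply: S_le.
have xE : x = (eps^-1)%R :> R by rewrite /x /Rdiv Rmult_1_l.
have hp : (1 <= (1 + delta) * p)%R by apply/RleP.
apply: S_ok_complete => //.
- by apply/andP; split; [apply/RltP | apply/RleP].
- exact/RltP.
- exact/RltP.
move=> k k0; rewrite -xE -INRE => /RleP Hk.
have k1 : 1 <= INR k by rewrite -[1]/(INR 1); apply: le_INR; apply/ssrnat.leP.
suff [r [r0 [Hr1 Hr2]]] : exists r : nat, (0 < r)%N /\
    x <= INR (k * r)%N /\ INR (k * r)%N <= Rpower 2 x.
  exists r => //; split; last exact: HN2.
  by rewrite -INRE; apply/RleP.
(* In general [k * r < x + k <= 2 * x <= 2 ^ x]. The last inequality fails for [1 < x < 2], where
   only [k = 1] occurs. *)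
have [x2|x2] := Rlt_le_dec x 2.
  have kE : k = 1%N.
    have : (k < 2)%N by apply/ssrnat.ltP; apply: INR_lt; rewrite /=; Lra.lra.
    by case: (k) k0 => [|[|]].
  exists 2%N; split=> //; rewrite kE /=.
  by have := @Rpower2_ge 1 x; rewrite /=; Lra.lra.
exists (ceil_nat (x / INR k)).
have xk : 0 < x / INR k by apply: Rdiv_lt_0_compat; Lra.lra.
split; first exact: ceil_nat_gt0.
have c1 := ceil_nat_ge (x / INR k); have c2 := @ceil_nat_lt (x / INR k) (Rlt_le _ _ xk).
have E : INR k * (x / INR k) = x by field; Lra.lra.
rewrite mult_INR; split; first by rewrite -{1}E; apply: Rmult_le_compat_l; Lra.lra.
have H : INR k * INR (ceil_nat (x / INR k)) <= INR k * (x / INR k + 1).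
  by apply: Rmult_le_compat_l; Lra.lra.
rewrite Rmult_plus_distr_l E in H.
have := @Rpower2_ge 2 x; rewrite /=; Lra.lra.
Qed.

(** A tower of height 0 or 1 leaves no room for additive constants, so the extreme parameters are
    settled by explicit graphs or vacuously. In the remaining range [L >= 1 / 2], and every constant
    is at most a multiple of [L]. *)
Lemma S_bound (eps delta p : R) : 0 < eps -> 0 < delta -> 0 < p ->
  INR (S eps delta p) <= twr (1 / eps) (ceil_nat (1300 * ln (1 / p) / delta ^ 2)).
Proof.
move=> e0 d0 p0; set h := ceil_nat _.
have ie0 : 0 < 1 / eps by apply: Rdiv_lt_0_compat; Lra.lra.
have twr0 : 1 / eps <= twr (1 / eps) h by apply: (@twr_le (1 / eps) 0 h).
have S0 : S_ok eps delta p 0 -> INR (S eps delta p) <= twr (1 / eps) h.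
  by move=> /S_le; rewrite leqn0 => /eqP->; rewrite /=; Lra.lra.
have [p1|p1] := Rle_lt_dec 1 p; first by apply: S0; apply: S_ok_dense; apply/RleP.
have [e1|e1] := Rlt_le_dec 1 eps.
  by apply: S0; apply: S_ok_large_eps; apply/RltP.
have [d1|d1] := Rle_lt_dec 1 delta.
  have [N [HN1 HN2]] := exists_floor (Rlt_le _ _ ie0).
  apply: Rle_trans twr0; apply: Rle_trans HN1; apply: le_INR; apply/ssrnat.leP; apply: S_le.
  apply: S_ok_empty; [exact/RltP | exact/RleP | move=> k].
  rewrite -INRE -[(_^-1)%R]/(/ eps) => /RleP Hk; apply: HN2.
  by rewrite /Rdiv Rmult_1_l.
have l0 : 0 < ln (1 / p).
  rewrite -ln_1; apply: ln_increasing; first by Lra.lra.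
  by apply: (Rmult_lt_reg_r p) => //; rewrite inv_mul; Lra.lra.
have dd0 : 0 < delta ^ 2 by apply: pow_lt.
pose L := ln (1 / p) / delta ^ 2.
have L0 : 0 < L by apply: Rdiv_lt_0_compat.
have hE : 1300 * ln (1 / p) / delta ^ 2 = 1300 * L by rewrite /L; field; Lra.lra.
have [Hp|Hp] := Rle_lt_dec 1 ((1 + delta) * p).
  by apply: S_bound_complete => //; apply: ceil_nat_gt0; rewrite hE; Lra.lra.
have Hl := ln_inv_ge d0 p0 Hp (Rlt_le _ _ d1).
have lE : ln (1 / p) = L * delta ^ 2 by rewrite /L; field; Lra.lra.
have dL : 1 / delta <= 2 * L.
  apply: (Rmult_le_reg_r (delta ^ 2)) => //.
  rewrite Rmult_assoc -lE (_ : 1 / delta * delta ^ 2 = delta); last by field; Lra.lra.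
  Lra.lra.
have L2 : / 2 <= L.
  have : 1 < 1 / delta.
    by apply: (Rmult_lt_reg_r delta) => //; rewrite inv_mul; Lra.lra.
  Lra.lra.
have d2 : delta ^ 2 <= 1 by rewrite /=; Lra.nra.
have lL : ln (1 / p) <= L.
  by rewrite lE -{2}(Rmult_1_r L); apply: Rmult_le_compat_l; Lra.lra.
have x1 : 1 <= 1 / eps.
  by apply: (Rmult_le_reg_r eps) => //; rewrite inv_mul; Lra.lra.
have dp0 : 0 < delta * p by apply: Rmult_lt_0_compat.
pose N := ceil_nat (1 / eps); pose A := ceil_nat (1 / (delta * p)).
(* For [a]: [1 / p <= exp L] and [1 / delta <= 2 * L <= exp (2 * L)]; the added 1 covers rounding
   [A] up. *)
pose T := ceil_nat (64 * L); pose a := ceil_nat (3 * L + 1).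
have N0 : (0 < N)%N by apply: ceil_nat_gt0.
have HA : (A <= 2 ^ (2 * a))%N.
  apply/ssrnat.leP; apply: INR_le; apply: Rle_trans (exp_le_pow4 (ceil_nat_ge _)).
  have A1 := ceil_nat_lt (Rlt_le _ _ (Rdiv_lt_0_compat _ _ Rlt_0_1 dp0)).
  have e3 : exp (3 * L) = exp (2 * L) * exp L by rewrite -exp_plus; congr exp; Lra.lra.
  have eL : 1 / p <= exp L.
    rewrite -(exp_ln (1 / p)); last by apply: Rdiv_lt_0_compat; Lra.lra.
    by case: lL => [lL|->]; [left; apply: exp_increasing | right].
  have e2 : 1 / delta <= exp (2 * L) by have := exp_ineq1_le (2 * L); Lra.lra.
  have H3 : 1 / (delta * p) <= exp (3 * L).
    rewrite e3 (_ : 1 / (delta * p) = 1 / delta * (1 / p)); last by field; Lra.lra.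
    by apply: Rmult_le_compat => //; left; apply: Rdiv_lt_0_compat; Lra.lra.
  rewrite exp_plus; have := exp_ineq1_le (3 * L); have := exp_ineq1_le 1.
  rewrite /A; Lra.nra.
have ok : S_ok eps delta p (16 * disc N (parts N T) ^ 4 * A).
  apply: S_ok_iterated => //.
  - exact: ceil_nat_ge.
  - exact: ceil_nat_ge.
  rewrite lE; have HT := ceil_nat_ge (64 * L); rewrite -/T in HT.
  by move: (delta ^ 2) dd0 => y y0; Lra.nra.
have B := leq_trans (S_le ok) (ntw_bound N0 T HA).
apply: Rle_trans (le_INR _ _ (elimT ssrnat.leP B)) _.
apply: Rle_trans (ntw_le_twr _ x1) _; apply: twr_le.
apply/ssrnat.leP; apply: INR_le; apply: Rle_trans (ceil_nat_ge _).
have HT := @ceil_nat_lt (64 * L); have Ha := @ceil_nat_lt (3 * L + 1).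
rewrite -/T in HT; rewrite -/a in Ha.
(* 18 T + 2 a + 24 <= 1158 L + 46 <= 1250 L, as 1 <= 2 L. *)
rewrite hE S_INR (plus_INR (18 * T + 2 * a)) (plus_INR (18 * T)) (mult_INR 18) (mult_INR 2).
have -> : INR 18 = 18 by rewrite INR_IZR_INZ.
have -> : INR 23 = 23 by rewrite INR_IZR_INZ.
have -> : INR 2 = 2 by [].
Lra.lra.
Qed.

End PolyRegularity.

Local Open Scope R_scope.

Theorem theorem1p5 :
  (exists c : R, forall eps delta p : R, 0 < eps -> 0 < delta -> 0 < p ->
     INR (S eps delta p) <= twr (1 / eps) (ceil_nat (c * ln (1 / p) / delta ^ 2)))
  /\
  (forall C delta0 : R, 0 < C -> 0 < delta0 ->
     exists c' : R, forall p : R, 0 < p ->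
       INR (S (Rpower p C) delta0 p) <= twr 1 (ceil_nat (c' * ln (1 / p)))).
Proof.
split; first by exists 1300; apply: S_bound.
move=> C delta C0 d0; have dd0 : 0 < delta ^ 2 by apply: pow_lt.
(* For [y = ln (1/p) <= y0] the first part bounds [S] by [2 ^ (3/2) < 3], hence
   by [2]; this is needed because the height may then be just [1]. *)
pose y0 := Rmin (delta ^ 2 / 1300) (1 / (3 * C)).
have y0_gt0 : 0 < y0.
  by apply: Rmin_pos; apply: Rdiv_lt_0_compat; Lra.lra.
(* The terms pay for the height from the first part, for a tower exceeding [1 / eps = exp (C * y)],
   and, once [y >= y0], for two roundings and one extra level. *)
pose c := 1300 / delta ^ 2 + 2 * C + 3 / y0.
have c0 : 0 < c.
  have : 0 < 1300 / delta ^ 2 by apply: Rdiv_lt_0_compat; Lra.lra.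
  have : 0 < 3 / y0 by apply: Rdiv_lt_0_compat; Lra.lra.
  by rewrite /c; Lra.lra.
exists c => p p0; have e0 : 0 < Rpower p C by apply: exp_pos.
have := S_bound e0 d0 p0; set y := ln (1 / p); set a := ceil_nat _.
have xE : 1 / Rpower p C = exp (C * y).
  rewrite /Rdiv Rmult_1_l -Rpower_Ropp /Rpower /y /Rdiv Rmult_1_l ln_Rinv //.
  by congr exp; Lra.lra.
rewrite xE => H; have [y_le0|y_gt0] := Rle_lt_dec y 0.
  have a0 : a = 0%N.
    apply: ceil_nat_le0; have i0 : 0 < / delta ^ 2 by apply: Rinv_0_lt_compat.
    by rewrite /Rdiv; Lra.nra.
  rewrite a0 /= in H; apply: Rle_trans H _.
  apply: (@Rle_trans _ (twr 1 0)); last exact: twr_le.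
  rewrite /= -exp_0; have : C * y <= 0 by Lra.nra.
  by case=> [Cy|->]; [left; apply: exp_increasing | right].
have [small|big] := Rle_lt_dec y y0.
  have y1 : 1300 * y / delta ^ 2 <= 1.
    have : y <= delta ^ 2 / 1300 by apply: Rle_trans small (Rmin_l _ _).
    move=> h; apply: (Rmult_le_reg_r (delta ^ 2)) => //.
    rewrite (_ : 1300 * y / delta ^ 2 * delta ^ 2 = 1300 * y); first by Lra.lra.
    by field; Lra.lra.
  have a1 : (a <= 1)%N.
    rewrite -ltnS; apply/ssrnat.ltP; apply: INR_lt.
    have := @ceil_nat_lt (1300 * y / delta ^ 2).
    have : 0 <= 1300 * y / delta ^ 2 by left; apply: Rdiv_lt_0_compat; Lra.lra.
    rewrite -/a; have -> : INR 2 = 2 by [].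
    by Lra.lra.
  have Cy : C * y <= 1 / 3.
    have : y <= 1 / (3 * C) by apply: Rle_trans small (Rmin_r _ _).
    move=> /(Rmult_le_compat_l C _ _ (Rlt_le _ _ C0)); move/Rle_trans; apply.
    by right; field; Lra.lra.
  have x32 : exp (C * y) <= 3 / 2.
    have H1 := exp_ineq1_le (- (C * y)); have H2 := exp_pos (C * y).
    have : exp (C * y) * exp (- (C * y)) = 1 by rewrite -exp_plus Rplus_opp_r exp_0.
    by Lra.nra.
  have H3 : Rpower 2 (3 / 2) < 3.
    have : Rpower 2 (3 / 2) * Rpower 2 (3 / 2) = 8.
      rewrite -Rpower_plus (_ : 3 / 2 + 3 / 2 = INR 3); last by rewrite /=; Lra.lra.
      by rewrite Rpower_pow /=; Lra.lra.
    have : 0 < Rpower 2 (3 / 2) by apply: exp_pos.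
    by Lra.nra.
  have S2 : INR (S (Rpower p C) delta p) < INR 3.
    have -> : INR 3 = 3 by rewrite /=; Lra.lra.
    apply: Rle_lt_trans H _; apply: Rle_lt_trans (twr_le _ a1) _.
    exact: Rle_lt_trans (Rpower2_mono x32) H3.
  have {}S2 : (S (Rpower p C) delta p <= 2)%N by rewrite -ltnS; apply/ssrnat.ltP; apply: INR_lt.
  apply: (@Rle_trans _ (twr 1 1)); last first.
    by apply: twr_le; apply: ceil_nat_gt0; apply: Rmult_lt_0_compat.
  rewrite /= Rpower_1; last by Lra.lra.
  by rewrite -[2]/(INR 2); apply: le_INR; apply/ssrnat.leP.
(* As [ln 2 > 1 / 2], [exp (C * y)] is below [2 ^ b], hence below a tower of height [b.+1] that can
   be placed on top of the other one. *)
pose b := ceil_nat (2 * (C * y)).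
have xb : exp (C * y) <= twr 1 b.+1.
  rewrite /=; apply: (@Rle_trans _ (Rpower 2 (INR b))); last first.
    by apply: Rpower2_mono; apply: INR_le_twr1.
  apply: (@Rle_trans _ (Rpower 2 (2 * (C * y)))); last first.
    by apply: Rpower2_mono; apply: ceil_nat_ge.
  rewrite /Rpower; have l2 := ln_lt_2; have Cy : 0 < C * y by apply: Rmult_lt_0_compat.
  by left; apply: exp_increasing; Lra.nra.
apply: Rle_trans H _; apply: Rle_trans (twr_base_le _ xb) _.
rewrite twr_add; apply: twr_le; apply/ssrnat.leP; apply: INR_le.
apply: Rle_trans (ceil_nat_ge _).
have z0 : 0 <= 1300 * y / delta ^ 2 by left; apply: Rdiv_lt_0_compat; Lra.lra.
have Cy : 0 <= 2 * (C * y) by have := Rmult_lt_0_compat _ _ C0 y_gt0; Lra.lra.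
have := ceil_nat_lt z0; have := ceil_nat_lt Cy; rewrite -/a -/b plus_INR S_INR.
have y3 : 3 <= 3 / y0 * y.
  have : 3 / y0 * y0 <= 3 / y0 * y.
    by apply: Rmult_le_compat_l; [left; apply: Rdiv_lt_0_compat; Lra.lra | left].
  by rewrite (_ : 3 / y0 * y0 = 3) //; field; Lra.lra.
have -> : c * y = 1300 * y / delta ^ 2 + 2 * (C * y) + 3 / y0 * y.
  by rewrite /c; field; Lra.lra.
by Lra.lra.
Qed.
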